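(* Let $0\le\alpha\in L^1([0,\infty))$, $0\le\sigma\in L^1_{\rm loc}([0,\infty))$, and $\beta(t):=\alpha(t)\exp\left(-\int_0^t\sigma(s)ds\right)$. Let $\rho_\pm>0$ and $u_\pm$ be constants, suppose that $u_-\le u_+$, and put $x_\pm(t)=u_\pm\int_0^t\beta(s)ds$. For $\varepsilon>0$ let $(\rho^\varepsilon,u^\varepsilon)$ be the solution of the viscosity problem $$\rho^\varepsilon_t+\alpha(t)(\rho^\varepsilon u^\varepsilon)_x=\varepsilon\beta(t)\rho^\varepsilon_{xx},\qquad u^\varepsilon_t+\tfrac12\alpha(t)\left((u^\varepsilon)^2\right)_x+\sigma(t)u^\varepsilon=\varepsilon\beta(t)u^\varepsilon_{xx},$$ with initial data $(\rho^\varepsilon,u^\varepsilon)(x,0)=(\rho_-,u_-)$ for $x<0$ and $(\rho_+,u_+)$ for $x>0$. Then the limit $$\lim_{\varepsilon\to0^+}(\rho^\varepsilon(x,t),u^\varepsilon(x,t))=(\rho(x,t),u(x,t))$$ exists in the sense of distributions, and the pair $(\rho(x,t),u(x,t))$ solves the time-variable coefficient Zeldovich approximate system with time-dependent damping $$\rho_t+\alpha(t)(\rho u)_x=0,\qquad u_t+\alpha(t)\left(\tfrac{u^2}{2}\right)_x=-\sigma(t)u$$ with initial data $(\rho,u)(x,0)=(\rho_-,u_-)$ for $x<0$ and $(\rho_+,u_+)$ for $x>0$. In addition, if $u_-<u_+$, then $$(\rho(x,t),u(x,t))=\begin{cases}\left(\rho_-,\,u_-\exp(-\int_0^t\sigma(s)ds)\right),&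 x<x_-(t),\\ \left(0,\,\frac{x}{\int_0^t\beta(s)ds}\exp(-\int_0^t\sigma(s)ds)\right),& x_-(t)<x<x_+(t),\\ \left(\rho_+,\,u_+\exp(-\int_0^t\sigma(s)ds)\right),& x>x_+(t),\end{cases}$$ and when $u_-=u_+$, then $$(\rho(x,t),u(x,t))=\begin{cases}\left(\rho_-,\,u_-\exp(-\int_0^t\sigma(s)ds)\right),& x<x_-(t),\\ \left(\rho_+,\,u_-\exp(-\int_0^t\sigma(s)ds)\right),& x>x_-(t).\end{cases}$$
   Context: Here $x\in\mathbb{R}$ and $t>0$. The solution $(\rho^\varepsilon,u^\varepsilon)$ of the viscosity problem is the explicit one: $\rho^\varepsilon=\partial_xW^\varepsilon$ and $u^\varepsilon=\frac{u_+b^\varepsilon_++u_-b^\varepsilon_-}{b^\varepsilon_++b^\varepsilon_-}\exp(-\int_0^t\sigma(s)ds)$, where, with $B(t)=\int_0^t\beta(s)ds$, $$b^\varepsilon_\pm(x,t)=\pm\frac{1}{(4\pi\varepsilon B(t))^{1/2}}\int_0^{\pm\infty}\exp\left(-\frac{(x-y)^2}{4\varepsilon B(t)}-\frac{u_\pm y}{2\varepsilon}\right)dy,$$ $$W^\varepsilon(x,t)=\frac{\rho_-(x-u_-B(t))b^\varepsilon_-+\rho_+(x-u_+B(t))b^\varepsilon_+}{b^\varepsilon_-+b^\varepsilon_+}+(\rho_+-\rho_-)\frac{(\varepsilon B(t))^{1/2}\exp\left(-\frac{x^2}{4\varepsilon B(t)}\right)}{\pi^{1/2}(b^\varepsilon_-+b^\varepsilon_+)}.$$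 *)

(* Defs.v *)
From mathcomp Require Export all_boot all_order all_algebra.
From mathcomp Require Export all_classical all_reals all_analysis.

Set Implicit Arguments.
Unset Strict Implicit.
Unset Printing Implicit Defensive.

Export Order.TTheory GRing.Theory Num.Theory.
Export numFieldNormedType.Exports.

#[global] Open Scope classical_set_scope.
#[global] Open Scope ring_scope.

(* Points of the plane are pairs (x, t): space first, time second. *)

Definition plane_measure (R : realType) :
    {measure set (measurableTypeR R * measurableTypeR R) -> \bar R} :=
  (@lebesgue_measure R \x @lebesgue_measure R)%E.

Definition open_half_plane (R : realType) : set (R * R) := [set p | 0 < p.2].

Definition closed_half_plane (R : realType) : set (R * R) := [set p | 0 <= p.2].

Definition L1loc_half_line (R : realType) (f : R -> R) : Prop :=
  forall T : R, lebesgue_measure.-integrable `[0, T] (EFin \o f).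

(* Local integrability up to the boundary points that belong to D. *)
Definition L1loc (R : realType) (D : set (R * R)) (f : R -> R -> R) : Prop :=
  forall K : set (R * R), K `<=` D -> compact K ->
    (plane_measure R).-integrable K (fun p => (f p.1 p.2)%:E).

Definition dx (R : realType) (f : R * R -> R) (p : R * R) : R :=
  derive1 (fun x => f (x, p.2)) p.1.

Definition dt (R : realType) (f : R * R -> R) (p : R * R) : R :=
  derive1 (fun t => f (p.1, t)) p.2.

(* All mixed partial derivatives of order at most k exist and are continuous. *)
Fixpoint Ck (R : realType) (k : nat) (f : R * R -> R) : Prop :=
  continuous f /\
  if k is k'.+1 then
    [/\ forall p : R * R, derivable (fun x => f (x, p.2)) p.1 1,
        forall p : R * R, derivable (fun t => f (p.1, t)) p.2 1,
        Ck k' (dx f) & Ck k' (dt f)]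
  else True.

Definition test_function (R : realType) (D : set (R * R)) (phi : R * R -> R) :
    Prop :=
  [/\ forall k, Ck k phi,
      compact (closure [set p | phi p != 0]) &
      closure [set p | phi p != 0] `<=` D].

(* Convergence as eps -> 0+ in the sense of distributions on R x (0, +oo), all
   the distributions involved being given by locally integrable functions. *)
Definition distribution_cvg (R : realType) (f : R -> R -> R -> R)
    (g : R -> R -> R) : Prop :=
  [/\ forall eps, 0 < eps -> L1loc (@open_half_plane R) (f eps),
      L1loc (@open_half_plane R) g &
      forall phi : R * R -> R, test_function (@open_half_plane R) phi ->
        \int[plane_measure R]_(p in @open_half_plane R)
          (f eps p.1 p.2 * phi p) @[eps --> 0^'+]
        --> \int[plane_measure R]_(p in @open_half_plane R)
          (g p.1 p.2 * phi p)].

(* q_t + f_x = s in R x (0, +oo) with q(., 0) = q0: the test functions are not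
   required to vanish at t = 0, which encodes the initial condition. *)
Definition weak_balance_law (R : realType) (q f s : R -> R -> R) (q0 : R -> R) :
    Prop :=
  [/\ L1loc (@closed_half_plane R) q,
      L1loc (@closed_half_plane R) f,
      L1loc (@closed_half_plane R) s &
      forall phi : R * R -> R, test_function [set: R * R] phi ->
        \int[plane_measure R]_(p in @closed_half_plane R)
          (q p.1 p.2 * dt phi p + f p.1 p.2 * dx phi p + s p.1 p.2 * phi p)
        + \int[lebesgue_measure]_x (q0 x * phi (x, 0)) = 0].

Definition riemann_data (R : realType) (l r x : R) : R :=
  if x < 0 then l else r.

(* The suffixes m and p stand for the subscripts - and +. *)
Definition zeldovich_solution (R : realType) (alpha sigma : R -> R)
    (rhom rhop um up : R) (rho u : R -> R -> R) : Prop :=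
  weak_balance_law rho (fun x t => alpha t * (rho x t * u x t))
    (fun _ _ => 0) (riemann_data rhom rhop)
  /\
  weak_balance_law u (fun x t => alpha t * (u x t ^+ 2 / 2))
    (fun x t => - (sigma t * u x t)) (riemann_data um up).

Definition damping (R : realType) (sigma : R -> R) (t : R) : R :=
  expR (- \int[lebesgue_measure]_(s in `[0, t]) sigma s).

Definition beta (R : realType) (alpha sigma : R -> R) (t : R) : R :=
  alpha t * damping sigma t.

Definition Bint (R : realType) (alpha sigma : R -> R) (t : R) : R :=
  \int[lebesgue_measure]_(s in `[0, t]) beta alpha sigma s.

Definition visc_integrand (R : realType) (eps B v x y : R) : R :=
  expR (- ((x - y) ^+ 2 / (4 * eps * B)) - v * y / (2 * eps)).

Definition bp (R : realType) (eps B up x : R) : R :=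
  (Num.sqrt (4 * pi * eps * B))^-1 *
  \int[lebesgue_measure]_(y in `[0, +oo[) visc_integrand eps B up x y.

(* The integral - \int_0^{-oo} is \int_{-oo}^0. *)
Definition bm (R : realType) (eps B um x : R) : R :=
  (Num.sqrt (4 * pi * eps * B))^-1 *
  \int[lebesgue_measure]_(y in `]-oo, 0]) visc_integrand eps B um x y.

Definition W_visc (R : realType) (eps B rhom rhop um up x : R) : R :=
  (rhom * (x - um * B) * bm eps B um x + rhop * (x - up * B) * bp eps B up x)
    / (bm eps B um x + bp eps B up x)
  + (rhop - rhom) *
    (Num.sqrt (eps * B) * expR (- (x ^+ 2 / (4 * eps * B)))
      / (Num.sqrt pi * (bm eps B um x + bp eps B up x))).

(* The explicit formulas divide by B(t).  If B(t) = 0, then alpha = 0 almost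
   everywhere on [0, t], the viscosity problem reduces there to rho_t = 0 and
   u_t + sigma u = 0, and its solution is the (damped) initial data, which is
   also the limit of the explicit formulas as B(t) -> 0+. *)
Definition rho_visc (R : realType) (alpha sigma : R -> R)
    (rhom rhop um up eps x t : R) : R :=
  let B := Bint alpha sigma t in
  if B == 0 then riemann_data rhom rhop x
  else derive1 (fun y => W_visc eps B rhom rhop um up y) x.

Definition u_visc (R : realType) (alpha sigma : R -> R)
    (um up eps x t : R) : R :=
  let B := Bint alpha sigma t in
  if B == 0 then riemann_data um up x * damping sigma t
  else (up * bp eps B up x + um * bm eps B um x)
         / (bp eps B up x + bm eps B um x) * damping sigma t.

(* Main.v *)
Require Import Defs.
From mathcomp Require Import ring lra.
From mathcomp Require Import measurable_realfun lebesgue_Rintegral lebesgue_integral_fubini.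

(** In the time variable B(t) = \int_0^t beta the damped problem becomes
autonomous: writing u = U * exp (- \int_0^t sigma), both the density rho and the
velocity U are functions of x and B alone, and the limit is the self-similar
Riemann solution, in which U is um, x / B or up and the density vanishes between
the two fronts x = um B and x = up B.  Two things have to be shown.

The limit is a weak solution.  A step that moves with speed v in the variable B
is constant along the curves x = y + v B(t).  After the area-preserving shear
(y, t) |-> (y + v B(t), t), testing such a step against phi amounts to
integrating the derivative of exp (- \int_0^t sigma) * phi (y + v B(t), t) along
each curve ([characteristic_integral]), which leaves the value - phi (y, 0) of
the initial data.  As beta and sigma are only integrable, this uses a chain rule
for absolutely continuous functions, [primitive_comp2].  The density is a
combination of three such profiles with their speeds as fluxes.  The rarefaction
wave U is a uniform limit of fans of n small steps, each step moving with the
mean of the two states it separates; by the Rankine-Hugoniot relation the flux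
of a fan is exactly half the square of the fan ([fan_shape], [fan_approx]), and
uniform limits preserve the weak formulation ([tested_law_limit]).

The viscous solutions converge to it.  Completing squares turns the integrals
b_- and b_+ into a common Gaussian factor times mills a and mills c, where
mills s = e^(s^2) \int_s^oo e^(-y^2) dy is the Mills ratio,
a = (x - um B) / 2k, c = - (x - up B) / 2k and k = (eps B)^(1/2); the factor
cancels.  With m = mills_slope = - mills' the potential becomes
  W = k (rhop m(c) - rhom m(a)) / (mills a + mills c),
and the velocity U = x / B - (k / B) (m(c) - m(a)) / (mills a + mills c).
Since um <= up we have a + c >= 0, and [mills_quotient] says that
m(c) / (mills a + mills c) is within a universal constant of 2 max (- c, 0).
The factor k in front then gives errors of order (eps B)^(1/2) for W and
(eps / B)^(1/2) for U, uniformly in x ([W_visc_dist], [U_visc_dist]).  So U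
converges pointwise and boundedly, and the velocity converges by dominated
convergence; for the density rho = W_x, the derivative is moved to the test
function on each horizontal line ([rho_line_bound]). *)
Set Implicit Arguments.
Unset Strict Implicit.
Unset Printing Implicit Defensive.

(** * Lebesgue measure on the plane *)

Section Plane.
Context (R : realType).
Local Notation mu := (@lebesgue_measure R).
Local Notation P := (measurableTypeR R * measurableTypeR R)%type.
Local Notation pm := (plane_measure R).
Implicit Types (f g : R * R -> R).

(** The product sigma-algebra is generated by rectangles; it contains the open sets
because each of them is the union of the countably many boxes with rational
centre and radius 1 / (n + 1) that it contains. *)
Lemma open_measurable_plane (U : set (R * R)) :
  open U -> measurable (U : set P).
Proof.
move=> oU.
pose box (q : rat * rat * nat) : set (R * R) :=
  [set p | `|p.1 - ratr q.1.1| < q.2.+1%:R^-1 /\ `|p.2 - ratr q.1.2| < q.2.+1%:R^-1].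
have -> : U = \bigcup_(q in [set q | box q `<=` U]) box q.
  apply/seteqP; split; last by move=> p [q qU]; exact: qU.
  move=> [x y] Uxy.
  have := oU; rewrite openE => /(_ _ Uxy) /nbhs_ballP [e /= e0 eU].
  have [n _ nP] := near_infty_natSinv_lt (PosNum (divr_gt0 e0 (ltr0n R 2))).
  have := nP n (leqnn _); rewrite /= => {}nP.
  have : 0 < n.+1%:R^-1 :> R by rewrite invr_gt0.
  rewrite /box; set d := n.+1%:R^-1 in nP * => d0.
  have itv (z : R) : z - d < z + d by lra.
  have [q1 ] := rat_in_itvoo (itv x).
  rewrite in_itv/= => /andP[q1a q1b].
  have [q2 ] := rat_in_itvoo (itv y).
  rewrite in_itv/= => /andP[q2a q2b].
  exists (q1, q2, n) => /=; rewrite -/d; last first.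
    by rewrite !ltr_norml; split; apply/andP; split; lra.
  move=> [a b]; rewrite /= !ltr_norml => -[/andP[? ?] /andP[? ?]].
  by apply: eU; split; rewrite /ball/= ltr_norml; apply/andP; split; lra.
rewrite bigcup_mkcond; apply: countable_bigcupT_measurable => //.
move=> q; case: ifPn => // _.
rewrite [X in measurable X](_ : _ =
  [set x : R | `|x - ratr q.1.1| < q.2.+1%:R^-1] `*`
      [set x : R | `|x - ratr q.1.2| < q.2.+1%:R^-1]); last first.
  by apply/seteqP; split => -[].
have mm (r s : R) : measurable ([set x : R | `|x - r| < s] : set (measurableTypeR R)).
  rewrite (_ : mkset _ = `]r - s, r + s[%classic).
    exact: measurable_itv.
  by apply/seteqP; split => x; rewrite /= in_itv/= ltr_norml => /andP[? ?]; apply/andP; split; lra.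
exact: (@measurableX _ _ (measurableTypeR R) (measurableTypeR R) _ _ (mm _ _) (mm _ _)).
Qed.

Lemma closed_measurable_plane (U : set (R * R)) :
  closed U -> measurable (U : set P).
Proof. by move=> /closed_openC/open_measurable_plane/measurableC; rewrite setCK. Qed.

Lemma compact_measurable_plane (U : set (R * R)) :
  compact U -> measurable (U : set P).
Proof.
by move/compact_closed => /(_ (@norm_hausdorff _ _)); exact: closed_measurable_plane.
Qed.

Lemma continuous_measurable_plane f :
  continuous f -> measurable_fun setT (f : P -> measurableTypeR R).
Proof.
move=> /continuousP cf; apply: (measurability _ (RGenOpens.measurableE R)).
move=> _ [_ [a [b ->] <-]]; rewrite setTI; apply: open_measurable_plane.
exact/cf/interval_open.
Qed.

Lemma measurable_addr (c : R) :
  measurable_fun setT (+%R c : measurableTypeR R -> measurableTypeR R).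
Proof. by apply: continuous_measurable_fun => x; apply: cvgD => //; exact: cvg_cst. Qed.

Lemma lebesgue_measure_translation (c : R) (A : set R) : measurable A ->
  pushforward mu (+%R c : measurableTypeR R -> measurableTypeR R) A = mu A.
Proof.
move=> mA; apply/esym/lebesgue_measure_unique => //=; first exact: measurable_addr.
move=> _ _ [[a b]] _ <-.
rewrite /pushforward (_ : _ @^-1` _ = `]a - c, b - c]%classic); last first.
  by apply/seteqP; split => x /=; rewrite !in_itv/= => /andP[? ?]; apply/andP; split; lra.
rewrite !lebesgue_measure_itv/= !lte_fin ltrD2r.
by case: ifP => // _; rewrite -!EFinB; congr (_%:E); lra.
Qed.

Lemma ge0_integral_translation (c : R) (F : R -> \bar R) :
  measurable_fun setT (F : measurableTypeR R -> \bar R) ->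
  (forall x, 0 <= F x)%E ->
  (\int[mu]_x F x = \int[mu]_x F (c + x)%R)%E.
Proof.
move=> mF F0; transitivity
    (\int[pushforward mu (+%R c : measurableTypeR R -> measurableTypeR R)]_x F x)%E.
- apply: eq_measure_integral; first exact: measurable_addr.
  by move=> mc A mA _; exact/esym/lebesgue_measure_translation.
- by rewrite (ge0_integral_pushforward (measurable_addr c)).
Qed.

Lemma integrable_translation (c : R) (F : R -> \bar R) :
  mu.-integrable setT F -> mu.-integrable setT (fun x => F (c + x)%R).
Proof.
move=> /integrableP[mF iF]; apply/integrableP; split.
  exact: (measurableT_comp mF (measurable_addr c)).
have mF' : measurable_fun setT (abse \o F) by exact: measurableT_comp.
by have /= <- := ge0_integral_translation c mF' (fun=> abse_ge0 _).
Qed.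

Lemma integral_translation (c : R) (F : R -> \bar R) :
  mu.-integrable setT F ->
  (\int[mu]_x F x = \int[mu]_x F (c + x)%R)%E.
Proof.
move=> iF; transitivity
    (\int[pushforward mu (+%R c : measurableTypeR R -> measurableTypeR R)]_x F x)%E.
- apply: eq_measure_integral; first exact: measurable_addr.
  by move=> mc A mA _; exact/esym/lebesgue_measure_translation.
- rewrite (integral_pushforward (measurable_addr c))//.
    exact: (measurable_int mu).
  by rewrite preimage_setT; exact: integrable_translation.
Qed.

(** The sections of such an f at time t have length at most 2M and height at most
a t, so Tonelli bounds the mass of f by 2M times the integral of a.  This
allows for coefficients that are merely locally integrable in time. *)
Lemma integrable_strip f (M : R) (a : R -> R) :
  measurable_fun setT (f : P -> R) ->
  mu.-integrable setT (EFin \o a) ->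
  (forall p, M < `|p.1| -> f p = 0) ->
  (forall p, `|f p| <= a p.2) ->
  pm.-integrable setT (EFin \o f : P -> _).
Proof.
move=> mf ia fM fa.
have mEf : measurable_fun setT (EFin \o f : P -> _) by exact/measurable_EFinP.
have a0 t : 0 <= a t by apply: le_trans (fa (0, t)).
apply/integrable21ltyP => //=.
apply: (@le_lt_trans _ _ (\int[mu]_y (mu `[(- M)%R, M]%classic * (a y)%:E)))%E.
  apply: ge0_le_integral => //.
  - by move=> y _; exact: integral_ge0.
  - have mab : measurable_fun setT (abse \o (EFin \o f) : P -> _).
      exact: measurableT_comp.
    exact: (measurable_fun_fubini_tonelli_G (m1 := mu) _ mab (fun=> abse_ge0 _)).
  - by apply: emeasurable_funM => //; exact: (measurable_int mu).
  move=> t _; rewrite (_ : (\int[_]_x _ = \int[mu]_(x in `[(- M)%R, M]) `|f (x, t)|%:E)%E);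
    last first.
    rewrite [RHS]integral_mkcond; apply: eq_integral => x _ /=.
    rewrite patchE; case: ifPn => //; rewrite notin_setE/= in_itv/= -ler_norml => /negP.
    by rewrite -ltNge => /(fM (x, t)) ->; rewrite normr0.
  apply: (@le_trans _ _ (\int[mu]_(x in `[(- M)%R, M]) (a t)%:E))%E.
    apply: ge0_le_integral => //.
    - apply/measurable_EFinP; apply: measurableT_comp => //.
      by apply: measurable_funTS; exact: (measurable_fun_pair1 _ mf).
    - by move=> x _; rewrite lee_fin; exact: (fa (x, t)).
  by rewrite integral_cst//= muleC.
have fM' : mu `[(- M)%R, M]%classic \is a fin_num.
  by rewrite lebesgue_measure_itv/=; case: ifP.
rewrite -(fineK fM') integralZl// ltey_eq fin_numM//.
exact: integrable_fin_num.
Qed.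

Lemma Rintegral_plane12 f : pm.-integrable setT (EFin \o f : P -> _) ->
  \int[pm]_p f p = \int[mu]_x \int[mu]_t f (x, t).
Proof.
move=> iF; rewrite /Rintegral; congr fine.
rewrite -(integral12_prod_meas1 iF); apply: ae_eq_integral => //.
- exact: (measurable_fubini_F iF).
- apply/measurable_EFinP; apply: measurableT_comp => //; exact: (measurable_fubini_F iF).
- apply: filterS (ae_integrable1 iF) => x /= ix _.
  by rewrite fineK//; exact: integrable_fin_num.
Qed.

Lemma Rintegral_plane21 f : pm.-integrable setT (EFin \o f : P -> _) ->
  \int[pm]_p f p = \int[mu]_t \int[mu]_x f (x, t).
Proof.
move=> iF; rewrite /Rintegral; congr fine.
rewrite -(integral21_prod_meas1 iF); apply: ae_eq_integral => //.
- exact: (measurable_fubini_G iF).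
- apply/measurable_EFinP; apply: measurableT_comp => //; exact: (measurable_fubini_G iF).
- apply: filterS (ae_integrable2 iF) => x /= ix _.
  by rewrite fineK//; exact: integrable_fin_num.
Qed.

End Plane.

(** * Shears and locally integrable functions *)

Section Shear.
Context (R : realType).
Local Notation mu := (@lebesgue_measure R).
Local Notation P := (measurableTypeR R * measurableTypeR R)%type.
Local Notation pm := (plane_measure R).
Implicit Types (f g : R * R -> R).

Lemma measurable_fst_plane : measurable_fun setT (fst : P -> measurableTypeR R).
Proof. exact: measurable_fst. Qed.

Lemma measurable_snd_plane : measurable_fun setT (snd : P -> measurableTypeR R).
Proof. exact: measurable_snd. Qed.

(** On each horizontal line the shear is a translation.  The two sides are the two
orders of integration: the inner integral on the right runs along the sheared
vertical lines, which will be the characteristics. *)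
Lemma integral_shear f (c : R -> R) :
  measurable_fun setT (c : measurableTypeR R -> R) ->
  pm.-integrable setT (EFin \o f : P -> _) ->
  pm.-integrable setT (fun p : P => (f (c p.2 + p.1, p.2))%:E) /\
  \int[pm]_p f p = \int[mu]_y \int[mu]_t f (c t + y, t).
Proof.
move=> mc iF.
have /integrableP[mF _] := iF.
have mS : measurable_fun setT (fun p : P => (c p.2 + p.1, p.2) : P).
  apply: measurable_fun_pair; last exact: measurable_snd_plane.
  by apply: measurable_funD;
    [exact: (measurableT_comp mc measurable_snd_plane)|exact: measurable_fst_plane].
have mG : measurable_fun setT (fun p : P => (f (c p.2 + p.1, p.2))%:E).
  exact: (measurableT_comp mF mS).
have iG : pm.-integrable setT (fun p : P => (f (c p.2 + p.1, p.2))%:E).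
  apply/integrable21ltyP => //=.
  have := (integrable21ltyP mu mu mF).1 iF; apply: le_lt_trans.
  rewrite le_eqVlt; apply/orP; left; apply/eqP; apply: eq_integral => t _ /=.
  apply/esym; apply: (@ge0_integral_translation R (c t) (fun x => `|f (x, t)|%:E)) => //.
  apply/measurable_EFinP; apply: measurableT_comp => //.
  by apply: (measurable_fun_pair1 (f := f)); exact/measurable_EFinP.
split => //.
rewrite -(Rintegral_plane12 iG) (Rintegral_plane21 iF) (Rintegral_plane21 iG) /Rintegral.
congr fine; apply: ae_eq_integral => //.
- apply/measurable_EFinP; apply: measurableT_comp => //; exact: (measurable_fubini_G iF).
- apply/measurable_EFinP; apply: measurableT_comp => //; exact: (measurable_fubini_G iG).
- apply: filterS (ae_integrable2 iF) => t /= it _.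
  by congr (fine _)%:E; exact: (integral_translation (c t) it).
Qed.

Lemma compact_plane_bounded (K : set (R * R)) : compact K ->
  exists M : R, 0 <= M /\ forall p, K p -> `|p.1| <= M /\ `|p.2| <= M.
Proof.
move=> /compact_bounded [M [_ MK]].
exists (`|M| + 1); split => [|p Kp]; first by rewrite addr_ge0.
have MM : M < `|M| + 1 by rewrite ltr_pwDr// ler_norm.
have : Num.max `|p.1| `|p.2| <= `|M| + 1 by exact: (MK _ MM _ Kp).
by rewrite ge_max => /andP.
Qed.

(** A compact set lies in a strip and in a bounded time interval, where
[integrable_strip] applies.  The function g stands for a version of f that is
measurable on the whole plane: coefficients depending on time are known to be
measurable for t >= 0 only and have to be cut off at t = 0. *)
Lemma L1loc_of_bound (D : set (R * R)) (f g : R -> R -> R) (a : R -> R) :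
  D `<=` @closed_half_plane R ->
  measurable_fun setT (fun p : P => g p.1 p.2) ->
  (forall x t, 0 <= t -> f x t = g x t) ->
  L1loc_half_line a ->
  (forall x t, 0 <= t -> `|g x t| <= a t) ->
  L1loc D f.
Proof.
move=> DH mg fg ia ga K KD cK.
have mK := compact_measurable_plane cK.
have [M [M0 MK]] := compact_plane_bounded cK.
pose g' (p : R * R) := g p.1 p.2 * (\1_`[- M, M] p.1 * \1_`[0, M] p.2).
have ig' : pm.-integrable setT (EFin \o g' : P -> _).
  apply: (@integrable_strip _ _ M (a \_ `[0, M])).
  - have mI (A : set R) : measurable (A : set (measurableTypeR R)) ->
        measurable_fun setT (\1_A : measurableTypeR R -> R).
      by move=> mA; exact: measurable_indic.
    apply: measurable_funM => //; apply: measurable_funM.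
      exact: (measurableT_comp (mI _ (measurable_itv _)) measurable_fst_plane).
    exact: (measurableT_comp (mI _ (measurable_itv _)) measurable_snd_plane).
  - by rewrite -restrict_EFin; apply/integrable_restrict => //; rewrite setTI; exact: ia.
  - move=> p Mp; rewrite /g' indicE memNset ?mul0r ?mulr0//= in_itv/= -ler_norml.
    by apply/negP; rewrite -ltNge.
  - move=> p; rewrite /g' patchE !indicE normrM.
    have [|_] := boolP (p.2 \in _); last by rewrite !mulr0 normr0 mulr0.
    rewrite inE/= in_itv/= => /andP[p0 _]; rewrite mulr1.
    by case: (_ \in _); rewrite ?normr1 ?normr0 ?mulr1 ?mulr0 ?(le_trans _ (ga p.1 _ p0))//;
      exact: ga.
have := integrableS measurableT mK (@subsetT _ _) ig'.
apply: eq_integrable => // p; rewrite inE => Kp /=.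
have [p1 p2] := MK _ Kp; have p0 : 0 <= p.2 by exact/DH/KD.
rewrite /g' fg// !indicE !mem_set ?mulr1//= in_itv/= -?ler_norml//.
by rewrite p0 (le_trans (ler_norm _)).
Qed.

Lemma measurable_half_line (f : R -> R) : L1loc_half_line f ->
  measurable_fun setT (f \_ `[0, +oo[ : measurableTypeR R -> R).
Proof.
move=> fi; apply/(measurable_restrictT _ _).1 => //.
have -> : `[0, +oo[%classic = \bigcup_n `[0 : R, n%:R]%classic.
  apply/seteqP; split => x /=; rewrite in_itv/= ?andbT.
    move=> x0; exists (Num.bound x) => //=; rewrite in_itv/= x0/= ltW//.
    by apply: le_lt_trans (archi_boundP x0); exact: lexx.
  by move=> [n _ /=]; rewrite !in_itv/= => /andP[].
apply/measurable_fun_bigcup => // n.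
by have /integrableP[/measurable_EFinP] := fi n%:R.
Qed.

End Shear.

(** * Primitives of integrable functions and the chain rule *)

Section Primitive.
Context (R : realType).
Local Notation mu := (@lebesgue_measure R).

(** Absolute continuity of F with derivative f, in integrated form, so that no
almost everywhere differentiation is needed. *)
Definition primitive (a b : R) (F f : R -> R) : Prop :=
  mu.-integrable `[a, b] (EFin \o f) /\
  forall s t, a <= s -> s <= t -> t <= b ->
    F t - F s = \int[mu]_(x in `[s, t]) f x.

Lemma Rintegral_itv_split (a s t : R) (f : R -> R) :
  a <= s -> s <= t -> mu.-integrable `[a, t] (EFin \o f) ->
  \int[mu]_(x in `[a, t]) f x =
  \int[mu]_(x in `[a, s]) f x + \int[mu]_(x in `[s, t]) f x.
Proof.
move=> as_ st fi.
have := @Rintegral_itvB R f (BLeft a) (BRight t) s fi.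
rewrite !bnd_simp => /(_ as_ st) E.
rewrite -(@Rintegral_itv_obnd_cbnd R s (BRight t) f).
  by rewrite -E; lra.
apply: integrableS fi => //.
by move=> x /=; rewrite !in_itv/= => /andP[? ->]; rewrite andbT (le_trans as_)// ltW.
Qed.

Lemma primitive_Rintegral0 (b : R) (f : R -> R) : L1loc_half_line f ->
  primitive 0 b (fun t => \int[mu]_(x in `[0, t]) f x) f.
Proof.
move=> fi; split => [|s t s0 st tb]; first exact: fi.
by rewrite (Rintegral_itv_split s0 st (fi t)); lra.
Qed.

(** For t < 0 the interval of integration is empty, so the function is the primitive
of the extension of f by 0. *)
Lemma continuous_Rintegral0 (f : R -> R) : L1loc_half_line f ->
  continuous (fun t : R => \int[mu]_(x in `[0, t]) f x).
Proof.
move=> fi t0.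
pose N := `|t0| + 1.
have N0 : 0 < N by rewrite ltr_wpDl.
pose f0 := f \_ `[0, +oo[.
have if0 t : mu.-integrable `[- N, t] (EFin \o f0).
  rewrite /f0 -restrict_EFin; apply/integrable_restrict => //.
  rewrite (_ : _ `&` _ = `[- N, t] `&` `[0, t]).
    by apply: (integrableS _ _ _ (fi t)) => //; exact: measurableI.
  apply/seteqP; split => x /=; rewrite !in_itv/= !andbT.
    by move=> [/andP[-> ->] ->].
  by move=> [/andP[-> ->] /andP[-> _]].
have E t : - N <= t -> \int[mu]_(x in `[0, t]) f x = \int[mu]_(x in `[- N, t]) f0 x.
  move=> Nt; rewrite /f0 -Rintegral_mkcondr; congr (\int[mu]_(_ in _) _).
  apply/seteqP; split => x /=; rewrite !in_itv/= !andbT.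
    by move=> /andP[x0 ->]; rewrite x0 (le_trans _ x0)// oppr_le0 ltW.
  by move=> [/andP[_ ->] ->].
have NN : - N < N by lra.
have := @parameterized_integral_continuous R (- N) N f0 (ltW NN) (if0 N).
move=> /(continuous_within_itvP _ NN)[+ _ _] => /(_ t0).
have t0N : t0 \in `]- N, N[.
  by rewrite in_itv/= -ltr_norml /N ltr_pwDr.
move=> /(_ t0N) c.
rewrite /continuous_at E; last by move: t0N; rewrite in_itv/= => /andP[/ltW].
apply: cvg_trans c; apply: near_eq_cvg; near=> t.
rewrite /parameterized_integral E//.
have : t \in `]- N, N[ by near: t; exact: near_in_itvoo.
by rewrite in_itv/= => /andP[/ltW].
Unshelve. all: by end_near. Qed.

(** The set of times t up to which the increment from a is bounded contains its
supremum and cannot stop before b, since an increment straddling the supremum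
can be appended to one that ends just before it. *)
Lemma straddle_le (a b : R) (G V : R -> R) : a <= b ->
  (forall t0, a <= t0 -> t0 <= b -> exists2 d, 0 < d & forall s t,
    a <= s -> s <= t0 -> t0 <= t -> t <= b -> t0 - d < s -> t < t0 + d ->
    `|G t - G s| <= V t - V s) ->
  `|G b - G a| <= V b - V a.
Proof.
move=> ab H.
pose A := [set t | [/\ a <= t, t <= b & `|G t - G a| <= V t - V a]].
have Aa : A a by split => //; rewrite !subrr normr0.
have hA : has_sup A by split; [exists a|exists b => t []].
have as_ : a <= sup A by apply: ub_le_sup => //; exact: hA.2.
have sb : sup A <= b by apply: ge_sup; [exists a|move=> t []].
have [d d0 Hd] := H _ as_ sb.
have [s [as1 sb1 Gs] ds] := sup_adherent d0 hA.
have ss : s <= sup A by apply: ub_le_sup => //; exact: hA.2.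
(* A time in A just before sup A, and a time t beyond sup A unless sup A = b. *)
pose t := Num.min b (sup A + d / 2).
have st : sup A <= t by rewrite /t le_min sb/= lerDl divr_ge0// ltW.
have tb : t <= b by rewrite /t ge_min lexx.
have td : t < sup A + d by rewrite /t gt_min; apply/orP; right; lra.
have Gt := Hd s t as1 ss st tb ds td.
have At : A t.
  split => //; first exact: le_trans st.
  have -> : G t - G a = (G t - G s) + (G s - G a) by lra.
  by rewrite (le_trans (ler_normD _ _))//; lra.
have ts : t <= sup A by apply: ub_le_sup => //; exact: hA.2.
have bs : b <= sup A.
  by move: ts; rewrite /t ge_min => /orP[//|]; lra.
by have -> : b = t; [lra|case: At].
Qed.

Lemma mean_value_deviation (f : R -> R) (x y c e : R) :
  (forall z, derivable f z 1) ->
  (forall z, Num.min x y <= z <= Num.max x y -> `|derive1 f z - c| <= e) ->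
  `|f y - f x - c * (y - x)| <= e * `|y - x|.
Proof.
move=> df fe.
wlog xy : x y fe / x <= y.
  move=> W; have [/W|/ltW yx] := leP x y; first exact.
  have := W y x _ yx; rewrite minC maxC => /(_ fe).
  have -> : f y - f x - c * (y - x) = - (f x - f y - c * (x - y)) by ring.
  by rewrite (distrC y x) normrN.
have [z zxy ->] : exists2 z, z \in `[x, y] & f y - f x = derive1 f z * (y - x).
  apply: MVT_segment => //.
    by move=> z _; rewrite derive1E; exact/derivableP.
  by apply: derivable_within_continuous => z _.
rewrite -mulrBl normrM ler_wpM2r// fe//.
by move: zxy; rewrite in_itv/= min_l// max_r.
Qed.

Lemma le_Rintegral_itv (s t : R) (f g : R -> R) :
  mu.-integrable `[s, t] (EFin \o f) -> mu.-integrable `[s, t] (EFin \o g) ->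
  (forall x, s <= x -> x <= t -> `|f x| <= g x) ->
  `|\int[mu]_(x in `[s, t]) f x| <= \int[mu]_(x in `[s, t]) g x.
Proof.
move=> fi gi fg; apply: le_trans (le_normr_Rintegral _ fi) _ => //.
have fi' : mu.-integrable `[s, t] (EFin \o (fun x => `|f x|)).
  exact: integrable_norm.
apply: le_Rintegral => // x; rewrite /= in_itv/= => /andP[? ?]; exact: fg.
Qed.

Lemma integrable_continuousM (a b : R) (g p : R -> R) :
  continuous g -> mu.-integrable `[a, b] (EFin \o p) ->
  mu.-integrable `[a, b] (EFin \o (fun t => g t * p t)).
Proof.
move=> cg ip.
have cI : compact (g @` `[a, b]).
  by apply: continuous_compact; [exact: continuous_subspaceT|exact: segment_compact].
have bg : [bounded g t | t in `[a, b]].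
  have [M [Mr MP]] := compact_bounded cI; exists M; split => // N MN t /= tab.
  by apply: (MP N MN); exists t.
have := @integrableMl _ _ _ mu `[a, b]%classic (measurable_itv _) _ _ ip
  (measurable_funTS (continuous_measurable_fun cg)) bg.
by apply: eq_integrable => // t _; rewrite /= -EFinM mulrC.
Qed.

Lemma integrableZ_itv (a b c : R) (f : R -> R) :
  mu.-integrable `[a, b] (EFin \o f) ->
  mu.-integrable `[a, b] (EFin \o (fun t => c * f t)).
Proof. by apply: integrable_continuousM => t; exact: cvg_cst. Qed.

Lemma integrableD_itv (a b : R) (f g : R -> R) :
  mu.-integrable `[a, b] (EFin \o f) -> mu.-integrable `[a, b] (EFin \o g) ->
  mu.-integrable `[a, b] (EFin \o (fun t => f t + g t)).
Proof.
move=> fi gi.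
have : mu.-integrable `[a, b] ((EFin \o f) \+ (EFin \o g))%E by apply: integrableD.
by apply: eq_integrable.
Qed.

Let alg1 (A B C D u v : R) :
  A * u + B * v - (C * u + D * v) = (A - C) * u + (B - D) * v.
Proof. ring. Qed.

Let alg2 (a b c d e f : R) : a - b - c = (a - d - e) + (d - b - f) - (c - (e + f)).
Proof. ring. Qed.

(** The functions x and y are merely integrable, so the composite need not have the
expected derivative at any given time.  Near a time r, however, the gradient of F
varies by at most e along the curve, and both the increment of F (X, Y) and the
integral of the claimed derivative over a short interval around r are then
within e times the integral of |x| + |y| of the same linear expression.
[straddle_le] adds up these local errors, and e is arbitrary. *)
Lemma primitive_comp2 (F : R * R -> R) (X Y x y : R -> R) (a b : R) :
  Ck 1 F -> continuous X -> continuous Y ->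
  primitive a b X x -> primitive a b Y y ->
  primitive a b (fun t => F (X t, Y t))
    (fun t => dx F (X t, Y t) * x t + dt F (X t, Y t) * y t).
Proof.
move=> [cF [dF1 dF2 [cFx _] [cFy _]]] cX cY [ix Xx] [iy Yy].
have cXY : continuous (fun t => (X t, Y t)) by move=> t; exact: cvg_pair (cX t) (cY t).
have cdx : continuous (fun t => dx F (X t, Y t)).
  by move=> t; apply: (continuous_comp (cXY t)); exact: cFx.
have cdt : continuous (fun t => dt F (X t, Y t)).
  by move=> t; apply: (continuous_comp (cXY t)); exact: cFy.
pose f t := dx F (X t, Y t) * x t + dt F (X t, Y t) * y t.
have fi : mu.-integrable `[a, b] (EFin \o f).
  exact: integrableD_itv (integrable_continuousM cdx ix) (integrable_continuousM cdt iy).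
split=> // s0 t0 as0 st0 tb.
have sub s t : s0 <= s -> t <= t0 -> `[s, t] `<=` `[a, b].
  move=> ss tt; apply: subset_itv; rewrite bnd_simp; lra.
have is_ s t (g : R -> R) : s0 <= s -> t <= t0 ->
    mu.-integrable `[a, b] (EFin \o g) -> mu.-integrable `[s, t] (EFin \o g).
  by move=> ss tt; apply: integrableS => //; exact: sub.
pose v t := `|x t| + `|y t|.
have iv : mu.-integrable `[a, b] (EFin \o v).
  exact: integrableD_itv (integrable_norm ix) (integrable_norm iy).
pose I g t := \int[mu]_(r in `[s0, t]) g r.
have IB g s t : mu.-integrable `[a, b] (EFin \o g) -> s0 <= s -> s <= t -> t <= t0 ->
    I g t - I g s = \int[mu]_(r in `[s, t]) g r.
  move=> ig ss st tt; rewrite /I (@Rintegral_itv_split s0 s t)//; first lra.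
  exact: is_.
pose G t := F (X t, Y t) - I f t.
suff GE : forall e, 0 < e -> `|G t0 - G s0| <= e * 2 * (I v t0 - I v s0).
  have C0 : 0 <= I v t0 - I v s0.
    rewrite IB//; apply: Rintegral_ge0 => r _; exact: addr_ge0.
  have : `|G t0 - G s0| <= 0.
    apply/ler_addgt0Pl => e e0; rewrite addr0.
    pose C := I v t0 - I v s0 + 1.
    have C1 : 0 < C by rewrite ltr_wpDl.
    apply: le_trans (GE (e / 2 / C) _) _; first by rewrite !divr_gt0.
    rewrite -/(C) (_ : e / 2 / C * 2 = e / C); last by field; rewrite gt_eqF.
    by rewrite mulrAC ler_pdivrMr// ler_pM2l// lerDl.
  rewrite normr_le0 subr_eq0 /G => /eqP E.
  have := IB f s0 t0 fi (lexx _) st0 (lexx _).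
  have : I f s0 = 0 by rewrite /I set_itv1 Rintegral_set1.
  rewrite -/f; lra.
move=> e e0; rewrite mulrBr.
apply: (@straddle_le _ _ G (fun t => e * 2 * I v t)) => // r sr rt.
have [d d0 Hd] : exists2 d, 0 < d & forall z w, `|z - X r| < d -> `|w - Y r| < d ->
    `|dx F (z, w) - dx F (X r, Y r)| <= e /\ `|dt F (z, w) - dt F (X r, Y r)| <= e.
  have /cvgrPdist_le/(_ e e0) H1 := cFx (X r, Y r).
  have /cvgrPdist_le/(_ e e0) H2 := cFy (X r, Y r).
  have [d /= d0 dP] := (nbhs_ballP (X r, Y r) _).1 (filterI H1 H2).
  exists d => // z w zd wd.
  have [] : (fun p => `|dx F (X r, Y r) - dx F p| <= e /\ `|dt F (X r, Y r) - dt F p| <= e) (z, w).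
    by apply: dP; split; rewrite /ball/= distrC.
  by rewrite distrC => -> /=; rewrite distrC => ->.
have [d' d'0 Hd'] : exists2 d', 0 < d' & forall t, `|t - r| < d' ->
    `|X t - X r| < d /\ `|Y t - Y r| < d.
  have /cvgrPdist_lt/(_ d d0) H1 := cX r.
  have /cvgrPdist_lt/(_ d d0) H2 := cY r.
  have [d' /= d'0 dP] := (nbhs_ballP r _).1 (filterI H1 H2).
  exists d' => // t td; rewrite (distrC (X t)) (distrC (Y t)).
  by apply: dP; rewrite /ball/= distrC.
exists d' => // s t ss sr' rt' tt ds dt_.
have st : s <= t by lra.
rewrite -mulrBr.
have -> : G t - G s = (F (X t, Y t) - F (X s, Y s)) - (I f t - I f s).
  rewrite /G; lra.
have At : a <= s by lra.
have tb' : t <= b by lra.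
rewrite !IB //.
have rs : `|s - r| < d' by rewrite ltr_norml; apply/andP; split; lra.
have rt'' : `|t - r| < d' by rewrite ltr_norml; apply/andP; split; lra.
have dq q : s <= q -> q <= t -> `|q - r| < d'.
  by move=> sq qt; rewrite ltr_norml; apply/andP; split; lra.
have [Xs Ys] := Hd' _ rs.
have [Xt Yt] := Hd' _ rt''.
have btw (u1 u2 u3 u0 : R) : `|u1 - u0| < d -> `|u2 - u0| < d ->
    Num.min u1 u2 <= u3 <= Num.max u1 u2 -> `|u3 - u0| < d.
  rewrite !ltr_norml ge_min le_max => /andP[? ?] /andP[? ?] /andP[/orP o1 /orP o2].
  by apply/andP; split; case: o1; case: o2; lra.
pose a1 := dx F (X r, Y r); pose b1 := dt F (X r, Y r).
have E1 := @mean_value_deviation (fun z => F (z, Y t)) (X s) (X t) a1 e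
  (fun z => dF1 (z, Y t)) (fun z zb => (Hd z (Y t) (btw _ _ _ _ Xs Xt zb) Yt).1).
have E2 := @mean_value_deviation (fun w => F (X s, w)) (Y s) (Y t) b1 e
  (fun w => dF2 (X s, w)) (fun w wb => (Hd (X s) w Xs (btw _ _ _ _ Ys Yt wb)).2).
have ixs := is_ s t x ss tt ix.
have iys := is_ s t y ss tt iy.
have ifs := is_ s t f ss tt fi.
have iax : mu.-integrable `[s, t] (EFin \o (fun q => `|x q|)) := integrable_norm ixs.
have iay : mu.-integrable `[s, t] (EFin \o (fun q => `|y q|)) := integrable_norm iys.
have X1 : `|X t - X s| <= \int[mu]_(q in `[s, t]) `|x q|.
  by rewrite Xx//; apply: le_Rintegral_itv.
have Y1 : `|Y t - Y s| <= \int[mu]_(q in `[s, t]) `|y q|.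
  by rewrite Yy//; apply: le_Rintegral_itv.
have V1 : \int[mu]_(q in `[s, t]) v q =
    \int[mu]_(q in `[s, t]) `|x q| + \int[mu]_(q in `[s, t]) `|y q|.
  exact: RintegralD.
pose g q := a1 * x q + b1 * y q.
have cc (c : R) : continuous (fun _ : R => c) by move=> ?; exact: cvg_cst.
have i1 := integrable_continuousM (cc a1) ixs.
have i2 := integrable_continuousM (cc b1) iys.
have igs : mu.-integrable `[s, t] (EFin \o g) by exact: integrableD_itv i1 i2.
have Ig : \int[mu]_(q in `[s, t]) g q = a1 * (X t - X s) + b1 * (Y t - Y s).
  rewrite Xx// Yy// -!RintegralZl//; exact: RintegralD.
have E3 : `|\int[mu]_(q in `[s, t]) f q - \int[mu]_(q in `[s, t]) g q| <=
    \int[mu]_(q in `[s, t]) (e * v q).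
  rewrite -RintegralB//; apply: le_Rintegral_itv.
  - have := integrableD_itv ifs (integrable_continuousM (cc (-1)) igs).
    by apply: eq_integrable => // q _ /=; rewrite mulN1r.
  - exact: (integrable_continuousM (cc e) (is_ s t v ss tt iv)).
  move=> q sq qt; have rq := dq _ sq qt.
  have [Xq Yq] := Hd' _ rq; have [Dx Dt] := Hd _ _ Xq Yq.
  have -> : f q - g q = (dx F (X q, Y q) - a1) * x q + (dt F (X q, Y q) - b1) * y q.
    exact: alg1.
  rewrite /v mulrDr; apply: le_trans (ler_normD _ _) _.
  by rewrite !normrM lerD// ler_wpM2r.
move: E3; rewrite RintegralZl//; last exact: is_.
rewrite Ig V1 => E3.
(* The increment of F is split at the corner (X s, Y t) of the rectangle, so that
   one variable changes at a time. *)
rewrite (alg2 _ _ _ (F (X s, Y t)) (a1 * (X t - X s)) (b1 * (Y t - Y s))).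
apply: le_trans (ler_normB _ _) _; apply: le_trans (lerD (ler_normD _ _) E3) _.
apply: le_trans (lerD (lerD E1 E2) (lexx _)) _.
rewrite -mulrDr -mulrDr -mulrA ler_wpM2l//; first exact: ltW.
rewrite mulr_natl mulr2n lerD2r lerD//.
Qed.

End Primitive.

(** * Test functions *)

Section TestFunctions.
Context (R : realType).
Local Notation mu := (@lebesgue_measure R).
Local Notation P := (measurableTypeR R * measurableTypeR R)%type.
Local Notation pm := (plane_measure R).
Implicit Types (phi : R * R -> R).

Lemma derive1_locally_zero (f : R -> R) (z : R) :
  (forall y, `|y - z| < 1 -> f y = 0) -> derive1 f z = 0.
Proof.
move=> fz; rewrite -(derive1_cst (0 : R) z) !derive1E.
apply: near_eq_derive.
near=> y; rewrite fz// distrC; near: y.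
Unshelve. all: by end_near. Qed.

Lemma test_function_box (D : set (R * R)) phi : test_function D phi ->
  exists2 M : R, 0 < M & forall p, M <= `|p.1| \/ M <= `|p.2| ->
    [/\ phi p = 0, dx phi p = 0 & dt phi p = 0].
Proof.
move=> [_ cK _].
have [M [M0 MK]] := compact_plane_bounded cK.
(* One unit of margin makes phi vanish near the points concerned, hence its
   derivatives vanish there too. *)
exists (M + 1); first by rewrite ltr_wpDl.
have phi0 p : M < `|p.1| \/ M < `|p.2| -> phi p = 0.
  move=> Mp; apply/eqP/negPn/negP => pp.
  have [] := MK p (@subset_closure _ [set p | phi p != 0] p pp).
  by case: Mp; rewrite ltNge => /negP.
have step (x y : R) : M + 1 <= `|x| -> `|y - x| < 1 -> M < `|y|.
  by move=> Mx yx; have := ler_distD y x 0; rewrite !subr0 distrC; lra.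
have lt1 (x : R) : M + 1 <= `|x| -> M < `|x| by apply: lt_le_trans; rewrite ltrDl.
move=> p [] Mp; split.
- by apply: phi0; left; exact: lt1.
- by apply: derive1_locally_zero => y yp; apply: phi0; left; exact: step yp.
- by apply: derive1_locally_zero => y yp; apply: phi0; left; exact: lt1.
- by apply: phi0; right; exact: lt1.
- by apply: derive1_locally_zero => y yp; apply: phi0; right; exact: lt1.
- by apply: derive1_locally_zero => y yp; apply: phi0; right; exact: step yp.
Qed.

Lemma continuous_box_bounded (f : R * R -> R) (M : R) : continuous f ->
  (forall p, M <= `|p.1| \/ M <= `|p.2| -> f p = 0) ->
  exists2 C : R, 0 <= C & forall p, `|f p| <= C.
Proof.
move=> cf f0.
have cI : compact (f @` (`[- M, M] `*` `[- M, M])).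
  apply: continuous_compact; first exact: continuous_subspaceT.
  by apply: compact_setX; exact: segment_compact.
have [C [Cr CP]] := compact_bounded cI.
exists (`|C| + 1); first by rewrite addr_ge0.
move=> p; have [/andP[p1 p2]|] := boolP ((`|p.1| < M) && (`|p.2| < M)).
  apply: (CP (`|C| + 1)); first by rewrite ltr_pwDr// ler_norm.
  by exists p => //; split; rewrite /= in_itv/= -ler_norml ltW.
rewrite negb_and -!leNgt => /orP p12; rewrite f0 ?normr0 ?addr_ge0//.
Qed.

End TestFunctions.

(** * Balance laws along characteristics *)

Section WeakLaw.
Context (R : realType).
Local Notation mu := (@lebesgue_measure R).
Local Notation P := (measurableTypeR R * measurableTypeR R)%type.
Local Notation pm := (plane_measure R).
Variables (b s : R -> R).
Hypotheses (bi : L1loc_half_line b) (si : L1loc_half_line s).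
Let B t := \int[mu]_(r in `[0, t]) b r.
Let S t := \int[mu]_(r in `[0, t]) s r.
Let E := damping s.
(* The hypotheses on b and s concern nonnegative times only; the extensions by 0
   are measurable on the whole line. *)
Let b0 := b \_ `[0, +oo[.
Let s0 := s \_ `[0, +oo[.

Lemma continuous_damping : continuous E.
Proof.
move=> t; rewrite /E /damping; apply: (@continuous_comp _ _ _ (fun t => - S t) expR).
  by apply: cvgN; exact: continuous_Rintegral0.
exact: continuous_expR.
Qed.

Lemma lebesgue_measure_segment (r t : R) : r <= t ->
  mu `[r, t]%classic = (t - r)%:E.
Proof.
rewrite lebesgue_measure_itv/= lte_fin le_eqVlt => /predU1P[->|->].
  by rewrite ltxx subrr.
by rewrite EFinB.
Qed.

Lemma primitive_id (r0 t0 : R) : primitive r0 t0 (fun t : R => t) (fun=> 1).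
Proof.
split.
  apply/integrableP; split; first exact: measurable_cst.
  under eq_integral do rewrite /= normr1.
  rewrite integral_cst//= mul1e lebesgue_measure_itv/=.
  by case: ifP => _; rewrite ?ltry// -EFinB ltry.
move=> r t _ rt _; rewrite Rintegral_cst// mul1r.
by rewrite -[LHS]/(fine (t - r)%:E); congr fine; apply/esym; exact: lebesgue_measure_segment.
Qed.

Lemma Rintegral0_0 (f : R -> R) : \int[mu]_(r in `[0, 0]) f r = 0.
Proof. by rewrite set_itv1 Rintegral_set1. Qed.

(** The exponential damping is put in as the outer function of the chain rule:
exp_mul (S t, phi) is the damped value of phi when S is a primitive of sigma. *)
Definition exp_mul (p : R * R) : R := expR (- p.1) * p.2.

Let is_derive_exp_mul1 (c x : R) :
  is_derive x 1 (fun a => expR (- a) * c : R) (- expR (- x) * c).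
Proof.
have e1 : is_derive x 1 (fun a : R => expR (- a)) (expR (- x) * -1).
  by apply: is_derive1_comp.
have -> : - expR (- x) * c = expR (- x) *: 0 + c *: (expR (- x) * -1).
  by rewrite scaler0 add0r /GRing.scale/=; ring.
exact: (is_deriveM e1 (is_derive_cst c x 1)).
Qed.

Let is_derive_exp_mul2 (c y : R) : is_derive y 1 (fun b => c * b : R) c.
Proof.
have e := is_deriveM (is_derive_cst c y 1) (is_derive_id y 1).
by apply: (is_derive_eq e); rewrite scaler0 addr0 /GRing.scale/= mulr1.
Qed.

Lemma dx_exp_mul : dx exp_mul = fun p => - expR (- p.1) * p.2.
Proof.
by apply/funext => p; rewrite /dx derive1E; have [] := is_derive_exp_mul1 p.2 p.1.
Qed.

Lemma dt_exp_mul : dt exp_mul = fun p => expR (- p.1).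
Proof.
by apply/funext => p; rewrite /dt derive1E; have [] := is_derive_exp_mul2 (expR (- p.1)) p.2.
Qed.

Let cexp1 : continuous (fun p : R * R => expR (- p.1)).
Proof.
move=> p; apply: (@continuous_comp _ _ _ (fun p => - p.1) expR).
  by apply: cvgN; exact: cvg_fst.
exact: continuous_expR.
Qed.

Lemma Ck1_exp_mul : Ck 1 exp_mul.
Proof.
split; first by move=> p; apply: cvgM; [exact: cexp1|exact: cvg_snd].
split.
- by move=> p; have [] := is_derive_exp_mul1 p.2 p.1.
- by move=> p; have [] := is_derive_exp_mul2 (expR (- p.1)) p.2.
- rewrite dx_exp_mul; split => // p.
  by apply: cvgM; [apply: cvgN; exact: cexp1|exact: cvg_snd].
- by rewrite dt_exp_mul; split => //; exact: cexp1.
Qed.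

Variables (phi : R * R -> R).
Hypothesis (tphi : test_function setT phi).

(** If q = E * Q, where E is the damping with rate s, and if the flux is E * b * F,
then the integrand of the weak form of q_t + f_x = - s q is
Q * time_rate + F * flux_rate.  Both rates vanish for negative time. *)
Definition time_rate (p : R * R) : R :=
  E p.2 * (\1_`[0, +oo[ p.2 * dt phi p - s0 p.2 * phi p).
Definition flux_rate (p : R * R) : R := E p.2 * (b0 p.2 * dx phi p).

Let phiC1 : Ck 1 phi. Proof. by case: tphi => /(_ 1%N). Qed.

Let cphi : continuous phi. Proof. by case: phiC1. Qed.
Let cdx : continuous (dx phi). Proof. by case: phiC1 => _ [_ _ []]. Qed.
Let cdt : continuous (dt phi). Proof. by case: phiC1 => _ [_ _ _ []]. Qed.

Let cB : continuous B. Proof. exact: continuous_Rintegral0. Qed.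
Let cS : continuous S. Proof. exact: continuous_Rintegral0. Qed.

Let rate_alg (e d1 d2 f s' b' v : R) :
  e * (1 * d1 - s' * f) + v * (e * (b' * d2)) =
  - e * f * s' + e * (d2 * (v * b') + d1 * 1).
Proof. ring. Qed.

(** For t >= 0 the integrand is the derivative of E(t) * phi (v * B t + y, t), which
equals phi (y, 0) at time 0 and vanishes at large times.  The chain rule is
applied twice: inside phi, then to the product with the damping. *)
Lemma characteristic_integral (v y : R) :
  mu.-integrable setT
    (EFin \o (fun t => time_rate (v * B t + y, t) + v * flux_rate (v * B t + y, t))) /\
  \int[mu]_t (time_rate (v * B t + y, t) + v * flux_rate (v * B t + y, t)) = - phi (y, 0).
Proof.
have [M M0 phiM] := test_function_box tphi.
pose X t := v * B t + y.
have cX : continuous X.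
  move=> t; apply: cvgD; last exact: cvg_cst.
  by apply: cvgM; [exact: cvg_cst|exact: cB].
have cid : continuous (fun t : R => t) by move=> t; exact: cvg_id.
have pB : primitive 0 M X (fun t => v * b t).
  have [iB BB] := primitive_Rintegral0 M bi.
  split.
    by apply: integrable_continuousM iB => t; exact: cvg_cst.
  move=> r t r0 rt tM; rewrite /X RintegralZl//.
    by rewrite -BB//; rewrite /B; lra.
  by apply: integrableS iB => //; apply: subset_itv; rewrite bnd_simp.
have pid := primitive_id 0 M.
have pZ := primitive_comp2 phiC1 cX cid pB pid.
have cZ : continuous (fun t => phi (X t, t)).
  by move=> t; apply: (continuous_comp (cvg_pair (cX t) (cid t))); exact: cphi.
have [iG G] := primitive_comp2 Ck1_exp_mul cS cZ (primitive_Rintegral0 M si) pZ.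
have S0 : S 0 = 0 by exact: Rintegral0_0.
have X0 : X 0 = y by rewrite /X /B Rintegral0_0 mulr0 add0r.
have : exp_mul (S M, phi (X M, M)) - exp_mul (S 0, phi (X 0, 0)) = _ :=
  G 0 M (lexx _) (ltW M0) (lexx _).
rewrite dx_exp_mul dt_exp_mul /exp_mul/= S0 X0.
have [-> _ _] := phiM (X M, M) (or_intror (ler_norm _)).
rewrite mulr0 oppr0 expR0 mul1r sub0r => ->.
rewrite [X in _ /\ _ = X]Rintegral_mkcond.
suff -> : (fun t => time_rate (v * B t + y, t) + v * flux_rate (v * B t + y, t)) =
    (fun t => dx exp_mul (S t, phi (X t, t)) * s t +
      dt exp_mul (S t, phi (X t, t)) *
      (dx phi (X t, t) * (v * b t) + dt phi (X t, t) * 1)) \_ `[0, M].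
  split; last by rewrite dx_exp_mul dt_exp_mul.
  by rewrite -restrict_EFin; apply/integrable_restrict => //; rewrite setTI.
apply/funext => t; rewrite dx_exp_mul dt_exp_mul patchE /time_rate /flux_rate /b0 /s0 !patchE
    indicE.
have -> : (t \in `[0, M]%classic) = (t \in `[0, +oo[%classic) && (t <= M).
  by rewrite !mem_setE !in_itv/= andbT.
have [t0|t0] := boolP (t \in `[0, +oo[%classic); last first.
 by rewrite /= !(mul0r, mulr0, subr0, addr0).
have [tM|tM] := leP t M; rewrite /=.
  rewrite /E /damping -/(S t) /X; exact: rate_alg.
have [-> -> ->] := phiM (v * B t + y, t) (or_intror (le_trans (ltW tM) (ler_norm _))).
by rewrite !(mulr0, subr0, addr0).
Qed.

Definition tested_law (Q F : R * R -> R) (Q0 : R -> R) : Prop :=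
  \int[pm]_p (Q p * time_rate p + F p * flux_rate p) = - \int[mu]_x (Q0 x * phi (x, 0)).

Let cE : continuous E. Proof. exact: continuous_damping. Qed.

Let mtime (f : R -> R) : measurable_fun setT (f : measurableTypeR R -> R) ->
  measurable_fun setT (fun p : P => f p.2).
Proof. by move=> mf; exact: (measurableT_comp mf (@measurable_snd_plane R)). Qed.

Let mE : measurable_fun setT (fun p : P => E p.2).
Proof. by apply: mtime; exact: continuous_measurable_fun. Qed.

Let mH : measurable_fun setT (fun p : P => \1_`[(0 : R), +oo[ p.2 : R).
Proof. by apply: (@mtime (\1_`[(0 : R), +oo[)); exact: measurable_indic. Qed.

Let E_ge0 t : 0 <= E t. Proof. exact: expR_ge0. Qed.

Let integrable_segment (M : R) (g : R -> R) :
  mu.-integrable `[0, M] (EFin \o g) ->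
  mu.-integrable setT (EFin \o ((fun t => E t * g t) \_ `[0, M])).
Proof.
move=> ig; rewrite -restrict_EFin; apply/integrable_restrict => //.
by rewrite setTI; exact: integrable_continuousM.
Qed.

Lemma integrable_time_rate : pm.-integrable setT (EFin \o time_rate : P -> _).
Proof.
have [M M0 phiM] := test_function_box tphi.
have [C1 C10 phiC] := continuous_box_bounded cphi (fun p Mp => let: And3 e _ _ := phiM p Mp in e).
have [C2 C20 dtC] := continuous_box_bounded cdt (fun p Mp => let: And3 _ _ e := phiM p Mp in e).
apply: (@integrable_strip R time_rate M ((fun t => E t * (C2 * 1 + C1 * `|s t|)) \_ `[0, M])).
- apply: measurable_funM; first exact: mE.
  apply: measurable_funB; apply: measurable_funM.
  + exact: mH.
  + exact: continuous_measurable_plane.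
  + by apply: mtime; exact: measurable_half_line.
  + exact: continuous_measurable_plane.
- apply: integrable_segment; apply: integrableD_itv; apply: integrableZ_itv.
    exact: (primitive_id 0 M).1.
  by have := integrable_norm (si M).
- by move=> p Mp; rewrite /time_rate; have [-> _ ->] := phiM p (or_introl (ltW Mp));
  rewrite !mulr0 subr0 mulr0.
move=> p; rewrite /time_rate /s0 !patchE indicE !mem_setE !in_itv/= andbT.
have [p0|p0] := leP 0 p.2; last by rewrite /= !mul0r subr0 mulr0 normr0.
have [pM|pM] := leP p.2 M; last first.
  have [-> _ ->] := phiM p (or_intror (le_trans (ltW pM) (ler_norm _))).
  by rewrite !mulr0 subr0 mulr0 normr0.
rewrite normrM ger0_norm// ler_wpM2l//= mul1r mulr1.
by apply: le_trans (ler_normB _ _) _; rewrite normrM mulrC lerD// mulrC [leRHS]mulrC ler_wpM2l.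
Qed.

Lemma integrable_flux_rate : pm.-integrable setT (EFin \o flux_rate : P -> _).
Proof.
have [M M0 phiM] := test_function_box tphi.
have [C C0 dxC] := continuous_box_bounded cdx (fun p Mp => let: And3 _ e _ := phiM p Mp in e).
apply: (@integrable_strip R flux_rate M ((fun t => E t * (C * `|b t|)) \_ `[0, M])).
- apply: measurable_funM; first exact: mE.
  apply: measurable_funM; last exact: continuous_measurable_plane.
  by apply: mtime; exact: measurable_half_line.
- apply: integrable_segment; apply: integrableZ_itv.
  by have := integrable_norm (bi M).
- by move=> p Mp; rewrite /flux_rate; have [_ -> _] := phiM p (or_introl (ltW Mp)); rewrite !mulr0.
move=> p; rewrite /flux_rate /b0 !patchE !mem_setE !in_itv/= andbT.
have [p0|p0] := leP 0 p.2; last by rewrite /= !mul0r mulr0 normr0.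
have [pM|pM] := leP p.2 M; last first.
  have [_ -> _] := phiM p (or_intror (le_trans (ltW pM) (ler_norm _))).
  by rewrite !mulr0 normr0.
by rewrite normrM ger0_norm// ler_wpM2l//= normrM mulrC ler_wpM2r.
Qed.

Lemma integrable_boundedM (Q g : R * R -> R) (C : R) :
  measurable_fun setT (Q : P -> R) -> (forall p, `|Q p| <= C) ->
  pm.-integrable setT (EFin \o g : P -> _) ->
  pm.-integrable setT (fun p : P => (Q p * g p)%:E).
Proof.
move=> mQ QC ig.
have bQ : [bounded Q p | p in [set: P]].
  exists C; split; first exact: num_real.
  by move=> N CN p _ /=; exact: le_trans (QC p) (ltW CN).
have := @integrableMl _ _ _ pm setT measurableT _ _ ig mQ bQ.
by apply: eq_integrable => // t _; rewrite /= -EFinM mulrC.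
Qed.

Let transport_alg (w' a v c : R) : w' * a + v * w' * c = w' * (a + v * c).
Proof. ring. Qed.

Lemma integrable_initial (w : R -> R) (C : R) :
  measurable_fun setT (w : measurableTypeR R -> R) -> (forall x, `|w x| <= C) ->
  mu.-integrable setT (fun x => (w x * phi (x, 0))%:E).
Proof.
move=> mw wC; have [M M0 phiM] := test_function_box tphi.
have cphi0 : continuous (fun x => phi (x, 0)).
  by move=> x; apply: (continuous_comp (cvg_pair cvg_id (cvg_cst 0))); exact: cphi.
have iphi : mu.-integrable setT (EFin \o (fun x => phi (x, 0))).
  have -> : (fun x => phi (x, 0)) = (fun x => phi (x, 0) * 1) \_ `[- M, M].
    apply/funext => x; rewrite patchE mem_setE in_itv/= -ler_norml mulr1.
    by case: leP => // /ltW xM; have [] := phiM (x, 0) (or_introl xM).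
  rewrite -restrict_EFin; apply/integrable_restrict => //; rewrite setTI.
  by apply: integrable_continuousM => //; exact: (primitive_id _ _).1.
have bw : [bounded w p | p in [set: R]].
  exists C; split; first exact: num_real.
  by move=> N CN p _ /=; exact: le_trans (wC p) (ltW CN).
have := @integrableMl _ _ _ mu setT measurableT _ _ iphi mw bw.
by apply: eq_integrable => // t _; rewrite /= -EFinM mulrC.
Qed.

(** The profile is constant along the characteristics of speed v; the shear makes
them the lines of integration, on each of which [characteristic_integral]
applies. *)
Lemma tested_law_transport (v : R) (w : R -> R) (C : R) :
  measurable_fun setT (w : measurableTypeR R -> R) -> (forall x, `|w x| <= C) ->
  tested_law (fun p => w (p.1 - v * B p.2)) (fun p => v * w (p.1 - v * B p.2)) w.
Proof.
move=> mw wC; rewrite /tested_law.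
pose g p := time_rate p + v * flux_rate p.
have ig : pm.-integrable setT (EFin \o g : P -> _).
  have iC : pm.-integrable setT (fun p : P => (v * flux_rate p)%:E).
    apply: (@integrable_boundedM (fun=> v) _ `|v|) => //.
    exact: integrable_flux_rate.
  have := integrableD measurableT integrable_time_rate iC.
  by apply: eq_integrable.
have mQ : measurable_fun setT (fun p : P => w (p.1 - v * B p.2)).
  apply: (measurableT_comp mw); apply: measurable_funB; first exact: measurable_fst_plane.
  apply: (@mtime (fun t => v * B t)); apply: continuous_measurable_fun => t.
  by apply: cvgM; [exact: cvg_cst|exact: cB].
pose f p := w (p.1 - v * B p.2) * g p.
have fi : pm.-integrable setT (EFin \o f : P -> _).
  exact: integrable_boundedM ig.
have mc : measurable_fun setT ((fun t => v * B t) : measurableTypeR R -> R).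
  apply: continuous_measurable_fun => t.
  by apply: cvgM; [exact: cvg_cst|exact: cB].
have [ish shE] := integral_shear mc fi.
transitivity (\int[pm]_p f p).
  by apply: eq_Rintegral => p _; exact: transport_alg.
rewrite shE -[RHS]mulN1r.
transitivity (\int[mu]_y (w y * (- phi (y, 0)))).
  apply: eq_Rintegral => y _; rewrite -(characteristic_integral v y).2 -RintegralZl//.
    by apply: eq_Rintegral => t _; rewrite /f /= [v * B t + y]addrC addrK.
  exact: (characteristic_integral v y).1.
rewrite -RintegralZl//; last exact: integrable_initial wC.
by apply: eq_Rintegral => y _; rewrite mulN1r mulrN.
Qed.

End WeakLaw.

(** * The Riemann solution and its approximation by fans of steps *)

Section Riemann.
Context (R : realType).
Variables (rm rp um up : R).

(** Here b stands for the value B(t).  The values on the fronts are chosen so that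
for b = 0, where the two fronts merge, riemann_rho and riemann_u are the initial
data. *)
Definition riemann_rho (x b : R) : R :=
  if x < um * b then rm else if up * b <= x then rp else 0.

Definition riemann_u (x b : R) : R :=
  if x < um * b then um else if up * b <= x then up else x / b.

Definition front_step (v x b : R) : R := if v * b <= x then 1 else 0.

Hypothesis um_le_up : um <= up.

Lemma riemann_rhoE (x b : R) : 0 <= b ->
  riemann_rho x b = rm + rp * front_step up x b - rm * front_step um x b.
Proof.
move=> b0; rewrite /riemann_rho /front_step.
have umb : um * b <= up * b by rewrite ler_wpM2r.
case: (ltP x (um * b)) => x1; case: (leP (up * b) x) => x2; lra.
Qed.

(** Each front carries its jump of density with its own speed, and nothing flows in
the vacuum between them; so the flux is the combination of steps that gives the
density, weighted by the speeds. *)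
Lemma riemann_fluxE (x b : R) : 0 <= b ->
  riemann_rho x b * riemann_u x b =
  um * rm + rp * (up * front_step up x b) - rm * (um * front_step um x b).
Proof.
move=> b0; rewrite /riemann_rho /riemann_u /front_step.
have umb : um * b <= up * b by rewrite ler_wpM2r.
case: (ltP x (um * b)) => x1; case: (leP (up * b) x) => x2; lra.
Qed.

Lemma riemann_u_bound (x b : R) : 0 <= b -> um <= riemann_u x b <= up.
Proof.
move=> b0; rewrite /riemann_u.
case: (ltP x (um * b)) => x1; first by rewrite lexx.
case: (leP (up * b) x) => x2; first by rewrite lexx um_le_up.
have b1 : 0 < b.
  rewrite lt_neqAle b0 andbT; apply/eqP => b00; move: x1 x2; rewrite -b00 !mulr0; lra.
by rewrite ler_pdivlMr// x1 ler_pdivrMr// ltW.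
Qed.

(** The i-th step of a fan separates the states um + i * d and um + (i + 1) * d and
moves with their mean, which is the Rankine-Hugoniot speed for the flux u^2 / 2. *)
Definition fan_speed (d : R) (i : nat) : R := um + (i%:R + 2^-1) * d.

Fixpoint fan_u (d : R) (n : nat) (x b : R) : R :=
  if n is k.+1 then fan_u d k x b + d * front_step (fan_speed d k) x b else um.

Fixpoint fan_flux (d : R) (n : nat) (x b : R) : R :=
  if n is k.+1 then
    fan_flux d k x b + d * (fan_speed d k * front_step (fan_speed d k) x b)
  else um / 2 * um.

Lemma fan_speed_le (d : R) (i j : nat) : 0 <= d -> (i <= j)%N ->
  fan_speed d i <= fan_speed d j.
Proof. by move=> d0 ij; rewrite lerD2l ler_wpM2r// lerD2r ler_nat. Qed.

(** The speeds increase with i, so the steps that have passed a given point are the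
j slowest ones.  The flux is exact because crossing step i changes it by
d * fan_speed d i, which is the difference of the half squares of the two
states. *)
Lemma fan_shape (d x b : R) (n : nat) : 0 <= d -> 0 <= b ->
  exists j : nat, [/\ (j <= n)%N, fan_u d n x b = um + j%:R * d,
    fan_flux d n x b = fan_u d n x b ^+ 2 / 2,
    (0 < j)%N -> fan_speed d j.-1 * b <= x &
    (j < n)%N -> x < fan_speed d j * b].
Proof.
move=> d0 b0; elim: n => [|n [j [jn uE fE lo hi]]].
  by exists 0%N; split => //=; [rewrite mul0r addr0|ring].
rewrite /= /front_step; case: leP => xn.
  have jE : j = n.
    apply/eqP; rewrite eqn_leq jn leqNgt; apply/negP => /hi xj.
    have := ler_wpM2r b0 (fan_speed_le d0 jn); lra.
  exists n.+1; split => //.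
  - by rewrite uE jE -natr1; ring.
  - by rewrite fE uE jE /fan_speed; field.
  - by rewrite ltnn.
exists j; split => //.
- exact: leqW.
- by rewrite mulr0 addr0.
- by rewrite !mulr0 !addr0.
by move=> _; move: jn; rewrite leq_eqVlt => /predU1P[->//|].
Qed.

(** Between the fronts j - 1 and j the quotient x / b lies between the two speeds,
each of which is at distance d / 2 from the state um + j * d. *)
Lemma fan_approx (n : nat) (x b : R) : (0 < n)%N -> 0 <= b ->
  let d := (up - um) / n%:R in
  [/\ `|riemann_u x b - fan_u d n x b| <= d,
      fan_flux d n x b = fan_u d n x b ^+ 2 / 2 &
      um <= fan_u d n x b <= up].
Proof.
move=> n0 b0 d.
have nR : 0 < n%:R :> R by rewrite ltr0n.
have d0 : 0 <= d by rewrite divr_ge0// subr_ge0.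
have nd : um + n%:R * d = up by rewrite /d mulrCA divff ?gt_eqF//; lra.
clearbody d.
have [j [jn uE fE lo hi]] := fan_shape x n d0 b0.
have jd : 0 <= j%:R * d by rewrite mulr_ge0.
have jnd : j%:R * d <= n%:R * d by rewrite ler_wpM2r// ler_nat.
split => //; last by rewrite uE; lra.
have speed_le i : (i < n)%N -> fan_speed d i <= up.
  move=> i_n; have := ler_wpM2r d0 (_ : i.+1%:R <= n%:R :> R).
  rewrite ler_nat => /(_ i_n); rewrite -natr1 /fan_speed; lra.
have speed_ge i : um <= fan_speed d i.
  by rewrite /fan_speed lerDl mulr_ge0// addr_ge0.
rewrite uE /riemann_u; case: (ltP x (um * b)) => x1.
  case: j jn lo hi jd jnd uE => [|j] jn lo hi jd jnd uE; first by rewrite mul0r addr0 subrr normr0.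
  have := ler_wpM2r b0 (speed_ge j); have := lo isT; rewrite /=; lra.
case: (leP (up * b) x) => x2.
  move: jn; rewrite leq_eqVlt => /predU1P[->|jn]; first by rewrite nd subrr normr0.
  have := ler_wpM2r b0 (speed_le _ jn); have := hi jn; lra.
have b1 : 0 < b.
  rewrite lt_neqAle b0 andbT; apply/eqP => b00; move: x1 x2; rewrite -b00 !mulr0; lra.
have y1 : um <= x / b by rewrite ler_pdivlMr.
have y2 : x / b < up by rewrite ltr_pdivrMr.
have y3 : (0 < j)%N -> fan_speed d j.-1 <= x / b.
  by move=> /lo; rewrite ler_pdivlMr.
have y4 : (j < n)%N -> x / b < fan_speed d j.
  by move=> /hi; rewrite ltr_pdivrMr.
rewrite ler_norml; apply/andP; split.
  case: j jn lo hi jd jnd uE y3 y4 => [|j] jn _ _ jd jnd _ y3 _; first lra.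
  have jS : j.+1%:R = j%:R + 1 :> R by rewrite natr1.
  by have := y3 isT; rewrite /fan_speed /= jS; lra.
move: jn; rewrite leq_eqVlt => /predU1P[jn|/y4]; last by rewrite /fan_speed; lra.
by rewrite jn; lra.
Qed.

End Riemann.

(** * Combinations and uniform limits of balance laws *)

Section Bounded.
Context (R : realType) d (T : measurableType d).
Implicit Types Q : T -> R.

Definition bounded_measurable Q : Prop :=
  measurable_fun setT Q /\ exists C, forall p, `|Q p| <= C.

Lemma bounded_measurable_cst (c : R) : bounded_measurable (fun=> c).
Proof. by split; [exact: measurable_cst|exists `|c|]. Qed.

Lemma bounded_measurableD Q Q' : bounded_measurable Q -> bounded_measurable Q' ->
  bounded_measurable (fun p => Q p + Q' p).
Proof.
move=> [mQ [C QC]] [mQ' [C' QC']]; split; first exact: measurable_funD.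
by exists (C + C') => p; rewrite (le_trans (ler_normD _ _))// lerD.
Qed.

Lemma bounded_measurableM Q Q' : bounded_measurable Q -> bounded_measurable Q' ->
  bounded_measurable (fun p => Q p * Q' p).
Proof.
move=> [mQ [C QC]] [mQ' [C' QC']]; split; first exact: measurable_funM.
by exists (C * C') => p; rewrite normrM ler_pM.
Qed.

Lemma bounded_measurableZ (c : R) Q : bounded_measurable Q ->
  bounded_measurable (fun p => c * Q p).
Proof. by move=> bQ; apply: bounded_measurableM => //; exact: bounded_measurable_cst. Qed.

End Bounded.

Section Laws.
Context (R : realType).
Local Notation mu := (@lebesgue_measure R).
Local Notation P := (measurableTypeR R * measurableTypeR R)%type.
Local Notation pm := (plane_measure R).
Variables (b s : R -> R).
Hypotheses (bi : L1loc_half_line b) (si : L1loc_half_line s).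
Let B t := \int[mu]_(r in `[0, t]) b r.
Variables (phi : R * R -> R).
Hypothesis (tphi : test_function setT phi).
Let A := time_rate s phi.
Let C := flux_rate b s phi.

(** Boundedness and measurability are kept together with the law because they make
all the integrals finite, which linearity and limits require. *)
Definition bounded_law (Q F : R * R -> R) (Q0 : R -> R) : Prop :=
  [/\ bounded_measurable (Q : P -> R), bounded_measurable (F : P -> R),
      bounded_measurable (Q0 : measurableTypeR R -> R) &
      tested_law b s phi Q F Q0].

Let iQA Q : bounded_measurable (Q : P -> R) ->
  pm.-integrable setT (fun p : P => (Q p * A p)%:E).
Proof.
move=> [mQ [c Qc]]; apply: integrable_boundedM Qc _ => //.
exact: integrable_time_rate.
Qed.

Let iFC F : bounded_measurable (F : P -> R) ->
  pm.-integrable setT (fun p : P => (F p * C p)%:E).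
Proof.
move=> [mQ [c Qc]]; apply: integrable_boundedM Qc _ => //.
exact: integrable_flux_rate.
Qed.

Let iQFAC Q F : bounded_measurable (Q : P -> R) -> bounded_measurable (F : P -> R) ->
  pm.-integrable setT (EFin \o (fun p : P => Q p * A p + F p * C p)).
Proof.
move=> bQ bF; have := integrableD measurableT (iQA bQ) (iFC bF).
by apply: eq_integrable.
Qed.

Let iQ0 (w : R -> R) : bounded_measurable (w : measurableTypeR R -> R) ->
  mu.-integrable setT (EFin \o (fun x => w x * phi (x, 0))).
Proof. by move=> [mw [c wc]]; apply: integrable_initial wc. Qed.

Let lin_alg (c c' q q' f f' a d : R) :
  (c * q + c' * q') * a + (c * f + c' * f') * d =
  c * (q * a + f * d) + c' * (q' * a + f' * d).
Proof. ring. Qed.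

Let lin_alg0 (c c' q q' a : R) :
  (c * q + c' * q') * a = c * (q * a) + c' * (q' * a).
Proof. ring. Qed.

Let RintegralZD d (T : measurableType d) (m : {measure set T -> \bar R}) (c c' : R) (f g : T -> R) :
  m.-integrable setT (EFin \o f) -> m.-integrable setT (EFin \o g) ->
  \int[m]_x (c * f x + c' * g x) = c * \int[m]_x f x + c' * \int[m]_x g x.
Proof.
move=> fi gi; rewrite -!RintegralZl//.
have Z (k : R) h : m.-integrable setT (EFin \o h) -> m.-integrable setT
    (EFin \o (fun x => k * h x)).
  move=> hi; have := integrableZl measurableT k hi; by apply: eq_integrable.
by rewrite RintegralD//; exact: Z.
Qed.

Lemma bounded_law_lin (c c' : R) Q F Q0 Q' F' Q0' :
  bounded_law Q F Q0 -> bounded_law Q' F' Q0' ->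
  bounded_law (fun p => c * Q p + c' * Q' p) (fun p => c * F p + c' * F' p)
    (fun x => c * Q0 x + c' * Q0' x).
Proof.
move=> [bQ bF b0 L] [bQ' bF' b0' L'].
split; try by apply: bounded_measurableD; exact: bounded_measurableZ.
rewrite /tested_law.
under eq_Rintegral do rewrite lin_alg.
under [in RHS]eq_Rintegral do rewrite lin_alg0.
rewrite RintegralZD; [|exact: iQFAC|exact: iQFAC].
rewrite RintegralZD; [|exact: iQ0|exact: iQ0].
by move: L L'; rewrite /tested_law -/A -/C => -> ->; rewrite !mulrN opprD.
Qed.

Let heaviside (x : R) : R := if 0 <= x then 1 else 0.

Let heavisideE : heaviside = \1_`[0, +oo[.
Proof.
by apply/funext => x; rewrite indicE mem_setE in_itv/= andbT /heaviside; case: ifP.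
Qed.

Lemma bounded_measurable_heaviside :
  bounded_measurable (heaviside : measurableTypeR R -> R).
Proof.
rewrite heavisideE; split; first exact: measurable_indic.
by exists 1 => p; rewrite indicE; case: (_ \in _); rewrite ?normr1// normr0.
Qed.

Lemma measurable_front (v : R) :
  measurable_fun setT (fun p : P => p.1 - v * B p.2).
Proof.
apply: measurable_funB; first exact: measurable_fst_plane.
apply: (measurableT_comp (f := fun t => v * B t)); last exact: measurable_snd_plane.
apply: continuous_measurable_fun => t.
by apply: cvgM; [exact: cvg_cst|exact: continuous_Rintegral0].
Qed.

Lemma bounded_law_step (v : R) :
  bounded_law (fun p => front_step v p.1 (B p.2)) (fun p => v * front_step v p.1 (B p.2)) heaviside.
Proof.
have [mh [c hc]] := bounded_measurable_heaviside.
have E : (fun p => front_step v p.1 (B p.2)) = fun p => heaviside (p.1 - v * B p.2).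
  by apply/funext => p; rewrite /front_step /heaviside subr_ge0.
have bs : bounded_measurable ((fun p => front_step v p.1 (B p.2)) : P -> R).
  rewrite E; split; first exact: (measurableT_comp mh (measurable_front v)).
  by exists c.
split => //.
- exact: bounded_measurableZ.
- exact: bounded_measurable_heaviside.
- rewrite (_ : (fun p => v * _) = fun p => v * heaviside (p.1 - v * B p.2)).
    by rewrite E; exact: tested_law_transport mh hc.
  by apply/funext => p; rewrite /front_step /heaviside subr_ge0.
Qed.

Lemma bounded_law_cst (v c : R) : bounded_law (fun=> c) (fun=> v * c) (fun=> c).
Proof.
split; try exact: bounded_measurable_cst.
by apply: (@tested_law_transport R b s bi si phi tphi v (fun=> c) `|c|).
Qed.

(** The rates of a test function are integrable, so a uniformly small change of Q
and F changes the tested integral by little.  Closeness is asked for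
nonnegative times only, where the rates live. *)
Lemma tested_law_limit (Q F : R * R -> R) (Q0 : R -> R) :
  bounded_measurable (Q : P -> R) -> bounded_measurable (F : P -> R) ->
  (forall e, 0 < e -> exists Q' F', bounded_law Q' F' Q0 /\
    forall p, 0 <= p.2 -> `|Q p - Q' p| <= e /\ `|F p - F' p| <= e) ->
  tested_law b s phi Q F Q0.
Proof.
move=> bQ bF H; rewrite /tested_law -/A -/C.
pose I := \int[pm]_p (`|A p| + `|C p|).
have iAC : pm.-integrable setT (EFin \o (fun p : P => `|A p| + `|C p|)).
  have iA : pm.-integrable setT (EFin \o A : P -> _) by exact: integrable_time_rate.
  have iC : pm.-integrable setT (EFin \o C : P -> _) by exact: integrable_flux_rate.
  have := integrableD measurableT (integrable_norm iA) (integrable_norm iC).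
  by apply: eq_integrable.
have I0 : 0 <= I by apply: Rintegral_ge0 => p _; exact: addr_ge0.
apply/eqP; rewrite -subr_eq0 -normr_le0.
apply/ler_addgt0Pl => e e0; rewrite addr0.
have [Q' [F' [[bQ' bF' _ L'] QF]]] := H (e / (I + 1)) (divr_gt0 e0 (ltr_wpDl I0 ltr01)).
rewrite -L' -/A -/C -RintegralB//; [|exact: iQFAC|exact: iQFAC].
have iD : pm.-integrable setT
    (EFin \o (fun p : P => Q p * A p + F p * C p - (Q' p * A p + F' p * C p))).
  have := integrableB measurableT (iQFAC bQ bF) (iQFAC bQ' bF').
  by apply: eq_integrable.
apply: (le_trans (le_normr_Rintegral measurableT iD)).
apply: (@le_trans _ _ (\int[pm]_p (e / (I + 1) * (`|A p| + `|C p|)))).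
  apply: le_Rintegral => //.
  - by have := integrable_norm iD; apply: eq_integrable.
  - have := integrableZl measurableT (e / (I + 1)) iAC; by apply: eq_integrable.
  move=> p _.
  have -> : Q p * A p + F p * C p - (Q' p * A p + F' p * C p) =
    (Q p - Q' p) * A p + (F p - F' p) * C p by ring.
  have [p0|p0] := leP 0 p.2; last first.
    have p0' : (p.2 \in `[0, +oo[%classic) = false.
      by rewrite mem_setE in_itv/= andbT leNgt p0.
    have -> : A p = 0 by rewrite /A /time_rate indicE patchE p0' !mul0r subr0 mulr0.
    have -> : C p = 0 by rewrite /C /flux_rate patchE p0' !mul0r mulr0.
    by rewrite !mulr0 normr0 addr0 normr0 mulr0.
  have [Qe Fe] := QF p p0.
  apply: (le_trans (ler_normD _ _)); rewrite !normrM mulrDr.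
  by apply: lerD; apply: ler_wpM2r.
rewrite RintegralZl// -/I.
by rewrite mulrAC ler_pdivrMr ?ltr_wpDl// ler_pM2l// lerDl.
Qed.

End Laws.

(** * Measurability of quotients *)

Section MeasInv.
Context (R : realType) d (T : measurableType d).
Implicit Types f g : T -> R.

(** The inverse is continuous except at 0. *)
Lemma measurable_inv : measurable_fun setT (@GRing.inv R : measurableTypeR R -> R).
Proof.
have -> : @GRing.inv R = fun x => if x == 0 then 0 else x^-1.
  by apply/funext => x; case: eqP => // ->; rewrite invr0.
apply: measurable_fun_if => //.
- by apply: measurable_fun_eqr => //; exact: measurable_cst.
- rewrite setTI (_ : _ @^-1` _ = [set x : R | x != 0]); last first.
    by apply/seteqP; split => x /=; [move=> /negbT|move=> /negbTE].
  apply: open_continuous_measurable_fun; first exact: open_neq.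
  by move=> x; rewrite inE/= => x0; exact: inv_continuous.
Qed.

Lemma measurable_fun_div f g : measurable_fun setT f -> measurable_fun setT g ->
  measurable_fun setT (fun x => f x / g x).
Proof.
move=> mf mg; apply: measurable_funM => //.
exact: (measurableT_comp measurable_inv mg).
Qed.

End MeasInv.

Lemma norm_bounds (R : realDomainType) (x : R) : - `|x| <= x <= `|x|.
Proof. by rewrite -ler_norml. Qed.

(** * The limit solves the damped system *)

Section ZeldovichSolution.
Context (R : realType).
Local Notation mu := (@lebesgue_measure R).
Local Notation P := (measurableTypeR R * measurableTypeR R)%type.
Local Notation pm := (plane_measure R).
Variables (alpha sigma : R -> R) (rm rp um up : R).
Hypotheses (alpha_ge0 : {ae mu, forall t, 0 <= t -> 0 <= alpha t})
  (alpha_L1 : mu.-integrable `[0, +oo[ (EFin \o alpha))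
  (sigma_L1loc : L1loc_half_line sigma)
  (um_le_up : um <= up).
Let E := damping sigma.
Let b := beta alpha sigma.
Let B := Bint alpha sigma.

Lemma alpha_L1loc : L1loc_half_line alpha.
Proof.
move=> T; apply: integrableS alpha_L1 => //.
by apply: subset_itv; rewrite bnd_simp.
Qed.

Lemma beta_L1loc : L1loc_half_line b.
Proof.
move=> T; rewrite /b /beta.
have := integrable_continuousM (continuous_damping sigma_L1loc) (alpha_L1loc T).
by apply: eq_integrable => // t _ /=; rewrite mulrC.
Qed.

Lemma Bint_ge0 t : 0 <= B t.
Proof.
rewrite /B /Bint.
have ib := beta_L1loc t.
have [mb _] := integrableP _ _ _ ib.
rewrite /Rintegral (@ae_eq_integral _ _ _ mu _ (fun s => `|(b s)%:E|%E))//.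
- by rewrite fine_ge0// integral_ge0.
- exact: measurableT_comp.
- move: alpha_ge0; apply: filterS; first exact: (ae_filter_ringOfSetsType mu).
  move=> s a0; rewrite /= in_itv/= => /andP[s0 _].
  by rewrite ger0_norm// mulr_ge0 ?a0// expR_ge0.
Qed.

Lemma continuous_Bint : continuous B.
Proof. exact: continuous_Rintegral0 beta_L1loc. Qed.

Lemma measurable_Bint : measurable_fun setT (fun p : P => B p.2).
Proof.
apply: (measurableT_comp (f := B)); last exact: measurable_snd_plane.
exact: continuous_measurable_fun continuous_Bint.
Qed.

Lemma damping_gt0 t : 0 < E t. Proof. exact: expR_gt0. Qed.

Definition rho_lim (x t : R) : R := riemann_rho rm rp um up x (B t).
Definition u_lim (x t : R) : R := riemann_u um up x (B t) * E t.

Lemma measurable_region (v : R) :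
  measurable_fun setT (fun p : P => p.1 < v * B p.2) /\
  measurable_fun setT (fun p : P => v * B p.2 <= p.1).
Proof.
have mvB : measurable_fun setT (fun p : P => v * B p.2).
  by apply: measurable_funM => //; exact: measurable_Bint.
split; first by apply: measurable_fun_ltr => //; exact: measurable_fst_plane.
by apply: measurable_fun_ler => //; exact: measurable_fst_plane.
Qed.

Lemma bounded_measurable_rho :
  bounded_measurable (fun p : P => rho_lim p.1 p.2).
Proof.
have [m1 _] := measurable_region um; have [_ m2] := measurable_region up.
split.
  rewrite /rho_lim /riemann_rho; apply: measurable_fun_ifT => //.
  exact: measurable_fun_ifT.
exists (`|rm| + `|rp|) => p; rewrite /rho_lim /riemann_rho.
case: ifP => _; first by rewrite lerDl.
by case: ifP => _; rewrite ?lerDr// normr0 addr_ge0.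
Qed.

Lemma bounded_measurable_riemann_u :
  bounded_measurable (fun p : P => riemann_u um up p.1 (B p.2)).
Proof.
have [m1 _] := measurable_region um; have [_ m2] := measurable_region up.
split.
  rewrite /riemann_u; apply: measurable_fun_ifT => //.
  apply: measurable_fun_ifT => //; apply: measurable_fun_div; first exact: measurable_fst_plane.
  exact: measurable_Bint.
exists (`|um| + `|up|) => p.
have /andP[h1 h2] := riemann_u_bound um_le_up p.1 (Bint_ge0 p.2).
have /andP[? ?] := norm_bounds um; have /andP[? ?] := norm_bounds up.
by rewrite ler_norml; apply/andP; split; lra.
Qed.

(** By [riemann_rhoE] and [riemann_fluxE] the density is a combination of a constant
and two steps; a constant may be given any speed, here um. *)
Lemma tested_law_riemann_rho (phi : R * R -> R) : test_function setT phi ->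
  tested_law b (fun=> 0) phi (fun p => rho_lim p.1 p.2)
    (fun p => rho_lim p.1 p.2 * riemann_u um up p.1 (B p.2)) (riemann_data rm rp).
Proof.
move=> tphi.
have z0 : L1loc_half_line (fun=> 0 : R).
  by move=> T; exact: integrable0.
have g1 := bounded_law_cst beta_L1loc z0 tphi um rm.
have gp := bounded_law_step beta_L1loc z0 tphi up.
have gm := bounded_law_step beta_L1loc z0 tphi um.
have := bounded_law_lin beta_L1loc z0 tphi 1 1 g1
    (bounded_law_lin beta_L1loc z0 tphi rp (- rm) gp gm).
move=> [_ _ _].
congr tested_law.
- apply/funext => p; rewrite /rho_lim riemann_rhoE//; last exact: Bint_ge0.
  by rewrite -/B !mul1r mulNr addrA.
- apply/funext => p; rewrite /rho_lim riemann_fluxE//; last exact: Bint_ge0.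
  by rewrite -/B !mul1r mulNr addrA.
- by apply/funext => x; rewrite /riemann_data /=; case: (ltP x 0) => x0; lra.
Qed.

(** The fans of [fan_approx] converge uniformly to riemann_u, and their fluxes to its
half square. *)
Lemma tested_law_riemann_u (phi : R * R -> R) : test_function setT phi ->
  tested_law b sigma phi (fun p => riemann_u um up p.1 (B p.2))
    (fun p => riemann_u um up p.1 (B p.2) ^+ 2 / 2) (riemann_data um up).
Proof.
move=> tphi.
have bU := bounded_measurable_riemann_u.
apply: tested_law_limit => //.
- exact: beta_L1loc.
- apply: bounded_measurableM; last exact: bounded_measurable_cst.
  exact: bounded_measurableM.
move=> e e0.
(* K bounds the mean of two states between um and up, so the flux error is at most
   K times the error of the state. *)
pose K := `|um| + `|up| + 1.
have K1 : 1 <= K by rewrite lerDr addr_ge0.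
have [n n1 ne] : exists2 n : nat, (0 < n)%N & (up - um) / n%:R <= e / K.
  pose y := (up - um) * K / e.
  have K0 : 0 < K := lt_le_trans ltr01 K1.
  have y0 : 0 <= y by rewrite divr_ge0 ?mulr_ge0 ?subr_ge0// ltW.
  exists (Num.bound y).+1 => //.
  rewrite ler_pdivrMr// mulrAC ler_pdivlMr// -ler_pdivrMl// mulrC -/y.
  by apply: ltW; apply: lt_trans (archi_boundP y0) _; rewrite ltr_nat.
pose d := (up - um) / n%:R.
have fanL : forall k, bounded_law b sigma phi (fun p => fan_u um d k p.1 (B p.2))
   (fun p => fan_flux um d k p.1 (B p.2)) (fun x => um + k%:R * d * (if 0 <= x then 1 else 0)).
  elim => [|k IH].
    have := bounded_law_cst beta_L1loc sigma_L1loc tphi (um / 2) um.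
    by congr bounded_law; apply/funext => x; rewrite mul0r mul0r addr0.
  have := bounded_law_lin beta_L1loc sigma_L1loc tphi 1 d IH
      (bounded_law_step beta_L1loc sigma_L1loc tphi (fan_speed um d k)).
  congr bounded_law; apply/funext => p /=.
  - by rewrite mul1r.
  - by rewrite mul1r.
  - by rewrite mul1r -[k.+1%:R]natr1 [(_ + 1) * d]mulrDl mul1r mulrDl addrA.
exists (fun p => fan_u um d n p.1 (B p.2)), (fun p => fan_flux um d n p.1 (B p.2)).
split.
  have := fanL n; congr bounded_law; apply/funext => x.
  rewrite /riemann_data /d mulrCA divff ?mulr1 ?pnatr_eq0 -?lt0n//.
  by case: (ltP x 0) => x0; lra.
move=> p _.
have [f1 f2 f3] := fan_approx um_le_up p.1 n1 (Bint_ge0 p.2).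
rewrite -/d in f1 f2 f3 ne.
have eK : e / K <= e by rewrite ler_pdivrMr ?(lt_le_trans ltr01)// ler_peMr// ltW.
split; first by apply: le_trans f1 _; exact: le_trans ne eK.
rewrite f2.
have /andP[h1 h2] := riemann_u_bound um_le_up p.1 (Bint_ge0 p.2).
set U := riemann_u _ _ _ _ in f1 h1 h2 *; set V := fan_u _ _ _ _ _ in f1 f3 *.
have -> : U ^+ 2 / 2 - V ^+ 2 / 2 = (U - V) * ((U + V) / 2) by field.
have UV : `|(U + V) / 2| <= K.
  move/andP: f3 => [? ?].
  have /andP[? ?] := norm_bounds um; have /andP[? ?] := norm_bounds up.
  by rewrite ler_norml /K; apply/andP; split; lra.
rewrite normrM; apply: (@le_trans _ _ (e / K * K)).
  by apply: ler_pM => //; exact: le_trans f1 ne.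
by rewrite divfK// gt_eqF// (lt_le_trans ltr01).
Qed.

Lemma L1loc_half_lineM (c : R) (f g : R -> R) : continuous g -> L1loc_half_line f ->
  L1loc_half_line (fun t => g t * `|f t| * c).
Proof.
move=> cg fi T.
have fi' : mu.-integrable `[0, T] (EFin \o (fun t => `|f t|)).
  exact: integrable_norm (fi T).
have := integrableZ_itv c (integrable_continuousM cg fi').
by apply: eq_integrable => // t _ /=; rewrite mulrC.
Qed.

Lemma L1loc_half_line_cst (c : R) : L1loc_half_line (fun=> c).
Proof.
move=> T; have := integrableZ_itv c (primitive_id 0 T).1.
by apply: eq_integrable => // t _ /=; rewrite mulr1.
Qed.

Let cE : continuous E. Proof. exact: continuous_damping. Qed.

Lemma measurable_damping : measurable_fun setT (fun p : P => E p.2).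
Proof.
apply: (measurableT_comp (f := E)); last exact: measurable_snd_plane.
exact: continuous_measurable_fun.
Qed.

(** The velocity, its source and both fluxes have this form, f being 1, alpha, beta
or the opposite of sigma. *)
Lemma L1loc_damped (D : set (R * R)) (f : R -> R) (g : R * R -> R) :
  D `<=` @closed_half_plane R -> L1loc_half_line f ->
  bounded_measurable (g : P -> R) ->
  L1loc D (fun x t => f t * (g (x, t) * E t)).
Proof.
move=> DH fi [mg [C gC]].
apply: (@L1loc_of_bound R D _ (fun x t => (f \_ `[0, +oo[) t * (g (x, t) * E t))
  (fun t => E t * `|f t| * C)) => //.
- apply: measurable_funM.
    apply: (measurableT_comp (f := f \_ `[0, +oo[)); last exact: measurable_snd_plane.
    exact: measurable_half_line.
  apply: measurable_funM; last exact: measurable_damping.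
  by have := mg; congr measurable_fun; apply/funext => -[].
- by move=> x t t0; rewrite patchE mem_set//= in_itv/= t0.
- exact: L1loc_half_lineM.
- move=> x t t0; rewrite patchE mem_set//=; last by rewrite in_itv/= t0.
  rewrite !normrM (ger0_norm (ltW (damping_gt0 t))).
  rewrite [`|g _| * _]mulrC mulrA [`|f t| * _]mulrC ler_wpM2l//.
  by rewrite mulr_ge0// ltW// damping_gt0.
Qed.

Lemma Rintegral_closed_half_plane (f g : R * R -> R) :
  (forall p, 0 <= p.2 -> f p = g p) -> (forall p, p.2 < 0 -> g p = 0) ->
  \int[pm]_(p in @closed_half_plane R) f p = \int[pm]_p g p.
Proof.
move=> fg g0; rewrite Rintegral_mkcond; apply: eq_Rintegral => p _.
rewrite patchE; case: ifPn => [|].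
  by rewrite inE /closed_half_plane/= => /fg.
by rewrite notin_setE /closed_half_plane/= => /negP; rewrite -ltNge => /g0 ->.
Qed.

Let flux_alg (r d a U e d2 f : R) :
  r * d + a * (r * (U * e)) * d2 + 0 * f =
  r * (1 * (1 * d - 0 * f)) + r * U * (1 * (a * e * d2)).
Proof. ring. Qed.

Let flux_alg2 (a U e : R) : a * ((U * e) ^+ 2 / 2) = a * e * (U ^+ 2 / 2 * e).
Proof. ring. Qed.

Let flux_alg3 (U e d a d2 s f : R) :
  U * e * d + a * ((U * e) ^+ 2 / 2) * d2 + - (s * (U * e)) * f =
  U * (e * (d - s * f)) + U ^+ 2 / 2 * (e * (a * e * d2)).
Proof. ring. Qed.

(** With u = U * E the flux of velocity is alpha * u^2 / 2 = E * beta * U^2 / 2 and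
that of density is beta * rho * U, so the integrands of the two weak formulations
are those of [tested_law], with damping for the velocity and without for the
density. *)
Lemma zeldovich_solution_lim :
  zeldovich_solution alpha sigma rm rp um up rho_lim u_lim.
Proof.
have bU := bounded_measurable_riemann_u.
have bR := bounded_measurable_rho.
have HH : @closed_half_plane R `<=` @closed_half_plane R by [].
have c1 := L1loc_half_line_cst 1.
have U2 : bounded_measurable (fun p : P => riemann_u um up p.1 (B p.2) ^+ 2 / 2).
  by apply: bounded_measurableM; [exact: bounded_measurableM|exact: bounded_measurable_cst].
have L0 : L1loc_half_line (fun=> 0 : R) := L1loc_half_line_cst 0.
split; split.
- have [mr [C rC]] := bR.
  apply: (@L1loc_of_bound R _ _ _ (fun=> C)) => //; last by move=> x t _; exact: rC (x, t).
    exact: mr.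
  exact: L1loc_half_line_cst.
- rewrite (_ : (fun x t => _) =
    (fun x t => alpha t * (rho_lim x t * riemann_u um up x (B t) * E t))).
    exact: (L1loc_damped HH alpha_L1loc (bounded_measurableM bR bU)).
  by apply/funext => x; apply/funext => t; rewrite /u_lim [rho_lim x t * _]mulrA.
- apply: (@L1loc_of_bound R _ _ (fun _ _ => 0) (fun=> 0)) => //.
  by move=> *; rewrite normr0.
- move=> phi tphi; have := tested_law_riemann_rho tphi.
  rewrite /tested_law => /eqP; rewrite -subr_eq0 opprK => /eqP W0; rewrite -[RHS]W0; congr (_ + _).
  have d1 t : damping (fun=> 0 : R) t = 1.
    by rewrite /damping /Rintegral integral0 oppr0 expR0.
  apply/Rintegral_closed_half_plane => p p0.
    rewrite /time_rate /flux_rate !patchE indicE mem_set//=; last by rewrite in_itv/= p0.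
    rewrite !d1 /u_lim /b /beta -/E; exact: flux_alg.
  rewrite /time_rate /flux_rate !patchE indicE memNset//=; last by rewrite in_itv/= leNgt p0.
  by rewrite !(mul0r, mulr0, subr0, addr0).
- rewrite (_ : u_lim = (fun x t => 1 * (riemann_u um up x (B t) * E t))).
    exact: (L1loc_damped HH c1 bU).
  by apply/funext => x; apply/funext => t; rewrite mul1r.
- rewrite (_ : (fun x t => _) = (fun x t => b t * (riemann_u um up x (B t) ^+ 2 / 2 * E t))).
    exact: (L1loc_damped HH beta_L1loc U2).
  by apply/funext => x; apply/funext => t; rewrite /u_lim /b /beta -/E; exact: flux_alg2.
- rewrite (_ : (fun x t => _) = (fun x t => (- sigma t) * (riemann_u um up x (B t) * E t))).
    apply: (L1loc_damped HH _ bU) => T.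
    have := integrableZ_itv (-1) (sigma_L1loc T).
    by apply: eq_integrable => // t _ /=; rewrite mulN1r.
  by apply/funext => x; apply/funext => t; rewrite mulNr.
- move=> phi tphi; have := tested_law_riemann_u tphi.
  rewrite /tested_law => /eqP; rewrite -subr_eq0 opprK => /eqP W0; rewrite -[RHS]W0; congr (_ + _).
  apply/Rintegral_closed_half_plane => p p0.
    rewrite /time_rate /flux_rate !patchE indicE mem_set//=; last by rewrite in_itv/= p0.
    rewrite mul1r /u_lim /b /beta -/E; exact: flux_alg3.
  rewrite /time_rate /flux_rate !patchE indicE memNset//=; last by rewrite in_itv/= leNgt p0.
  by rewrite !(mul0r, mulr0, subr0, addr0).
Qed.

End ZeldovichSolution.

(** * The Mills ratio of the Gaussian *)

Section Mills.
Context (R : realType).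
Local Notation mu := (@lebesgue_measure R).

Definition gauss_tail (x : R) : R := \int[mu]_(y in `]-oo, x]) gauss_fun y.

Lemma integrable_gauss_tail (x : R) : mu.-integrable `]-oo, x] (EFin \o @gauss_fun R).
Proof. by apply: integrableS (@integrableT_gauss R). Qed.

Lemma is_derive_gauss_tail (x : R) : is_derive x 1 gauss_tail (gauss_fun x).
Proof.
have x1 : x < x + 1 by rewrite ltrDl.
have [d e] := @continuous_FTC1 R (@gauss_fun R) -oo%O x (x + 1) x1
  (integrable_gauss_tail _) (ltNyr x) (@continuous_gauss_fun R x).
by apply: DeriveDef => //; rewrite -derive1E.
Qed.

Lemma gauss_tail_gt0 x : 0 < gauss_tail x.
Proof.
have [z _ E] : exists2 z, z \in `[x - 1, x] &
    gauss_tail x - gauss_tail (x - 1) = gauss_fun z * (x - (x - 1)).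
  apply: MVT_segment; first by rewrite lerBlDr lerDl.
    by move=> z _; exact: is_derive_gauss_tail.
  apply: derivable_within_continuous => z _.
  by have [] := is_derive_gauss_tail z.
have g0 : 0 <= gauss_tail (x - 1).
  by apply: Rintegral_ge0 => y _; exact: gauss_fun_ge0.
have : 0 < gauss_fun z by exact: expR_gt0.
by move: E; rewrite opprB addrCA subrr addr0 mulr1; lra.
Qed.

Lemma gauss_tail_affine (k z : R) : 0 < k ->
  (\int[mu]_(y in `]-oo, 0%R]) (gauss_fun ((y - z) / k))%:E =
   (k * gauss_tail (- z / k))%:E)%E.
Proof.
move=> k0.
pose F (y : R) : R := (y - z) / k.
have dF (y : R) : is_derive y 1 F k^-1.
  have e : is_derive y 1 F _ :=
    is_deriveM (is_deriveB (is_derive_id y 1) (is_derive_cst z y 1)) (is_derive_cst k^-1 y 1).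
  by apply: (is_derive_eq e); rewrite /GRing.scale/= subr0 mulr1 mulr0 add0r.
have F'E : derive1 F = cst k^-1.
  by apply/funext => y; rewrite derive1E; have [] := dF y.
have F0 : F 0 = - z / k by rewrite /F sub0r.
have cF : continuous F.
  move=> y; apply: differentiable_continuous; apply/derivable1_diffP.
  by have [] := dF y.
have E : (\int[mu]_(x in `]-oo, F 0%R]) (gauss_fun x)%:E =
    \int[mu]_(x in `]-oo, 0%R]) (((@gauss_fun R \o F) * derive1 F)%R x)%:E)%E.
  apply: increasing_ge0_integration_by_substitutionNy; rewrite ?F'E.
  - by move=> x y _ _ xy; rewrite /F ltr_pM2r ?invr_gt0// ltrD2r.
  - by move=> y _; exact: cvg_cst.
  - exact: is_cvg_cst.
  - exact: cvg_cst.
  - split; last by apply: cvg_at_left_filter; exact: cF.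
    by move=> y _; have [] := dF y.
  - apply/cvgrNyPle => A; near=> y.
    rewrite /F ler_pdivrMr// lerBlDr; near: y; apply: nbhs_ninfty_le; exact: num_real.
  - exact/continuous_subspaceT/continuous_gauss_fun.
  - by move=> y _; exact: gauss_fun_ge0.
rewrite EFinM fineK; last exact: integrable_fin_num (integrable_gauss_tail _).
rewrite -F0 [X in (_ * X)%E]E -ge0_integralZl//=.
- apply: eq_integral => y _; rewrite F'E -EFinM; congr EFin.
  by rewrite /= mulrCA divff ?mulr1// gt_eqF.
- apply/measurable_EFinP; rewrite F'E; apply: measurable_funM => //.
  apply: measurable_funTS; apply: continuous_measurable_fun => y.
  by apply: (continuous_comp (cF y)); exact: continuous_gauss_fun.
- by move=> y _; rewrite F'E lee_fin mulr_ge0 ?gauss_fun_ge0// invr_ge0 ltW.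
- by rewrite lee_fin ltW.
Unshelve. all: by end_near. Qed.

(** Since the Gaussian is even, this is the Mills ratio e^(s^2) \int_s^oo e^(-y^2) dy. *)
Definition mills (s : R) : R := expR (s ^+ 2) * gauss_tail (- s).

Lemma mills_gt0 s : 0 < mills s.
Proof. by rewrite mulr_gt0 ?expR_gt0 ?gauss_tail_gt0. Qed.

Lemma is_derive_mills (s : R) : is_derive s 1 mills (2 * s * mills s - 1).
Proof.
have d1 : is_derive s 1 (fun s : R => gauss_tail (- s)) (gauss_fun (- s) * -1).
  by apply: is_derive1_comp; exact: is_derive_gauss_tail.
have d2 : is_derive s 1 (fun s : R => expR (s ^+ 2)) (expR (s ^+ 2) * (s *+ 2)).
  apply: is_derive1_comp.
  have e : is_derive s 1 (fun s : R => s ^+ 2) _ := is_deriveX 2 (is_derive_id s 1).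
  by apply: (is_derive_eq e); rewrite /GRing.scale/= expr1 mulr1 mulr_natl.
have e : is_derive s 1 mills _ := is_deriveM d2 d1.
apply: (is_derive_eq e); rewrite /GRing.scale/= /mills /gauss_fun sqrrN.
have : expR (s ^+ 2) * expR (- s ^+ 2) = 1 by rewrite expRN divff// gt_eqF// expR_gt0.
move: (expR (s ^+ 2)) (expR (- s ^+ 2)) (gauss_tail (- s)) => x y z xy.
by rewrite mulrN1 mulrN xy -mulr_natr; ring.
Qed.

Lemma continuous_mills : continuous mills.
Proof.
move=> y; apply: differentiable_continuous; apply/derivable1_diffP.
by have [] := is_derive_mills y.
Qed.

(** Completing the square, mills s is the integral over y <= 0 of
exp (- y^2 + 2 s y), whose integrand decreases in s. *)
Lemma mills_le (s t : R) : s <= t -> mills t <= mills s.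
Proof.
move=> st.
have E r : (mills r)%:E = (\int[mu]_(y in `]-oo, 0%R]) (expR (- y ^+ 2 + 2 * r * y))%:E)%E.
  have A := gauss_tail_affine r ltr01; rewrite mul1r [- r / 1]divr1 in A.
  rewrite /mills EFinM -A.
  rewrite -ge0_integralZl//=.
  - apply: eq_integral => y _; rewrite -EFinM -expRD; congr (expR _)%:E.
    by rewrite divr1; ring.
  - apply/measurable_EFinP; apply: measurable_funTS.
    apply: continuous_measurable_fun => y.
    apply: (@continuous_comp _ _ _ (fun y : R => (y - r) / 1) (@gauss_fun R));
      last exact: continuous_gauss_fun.
    by apply: cvgM; [apply: cvgB; [exact: cvg_id|exact: cvg_cst]|exact: cvg_cst].
  - by move=> y _; rewrite lee_fin gauss_fun_ge0.
have mexp (r : R) : measurable_fun `]-oo, (0 : R)]%classic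
    (fun y : R => (expR (- y ^+ 2 + 2 * r * y))%:E : \bar R).
  apply/measurable_EFinP; apply: measurable_funTS; apply: continuous_measurable_fun => y.
  apply: (@continuous_comp _ _ _ (fun y : R => - y ^+ 2 + 2 * r * y) expR);
    last exact: continuous_expR.
  apply: cvgD; first by apply: cvgN; exact: exprn_continuous.
  by apply: cvgM; [exact: cvg_cst|exact: cvg_id].
rewrite -lee_fin !E; apply: ge0_le_integral => //.
- exact: mexp.
- exact: mexp.
- move=> y; rewrite /= in_itv/= => y0; rewrite lee_fin ler_expR lerD2l.
  by rewrite ler_wnM2r// ler_pM2l.
Qed.

(** The opposite of the derivative of mills. *)
Definition mills_slope (s : R) : R := 1 - 2 * s * mills s.

Lemma mills_slope_ge0 s : 0 <= mills_slope s.
Proof.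
rewrite /mills_slope.
apply/ler_addgt0Pr => e e0.
(* The tilt e * t makes f strictly increasing. *)
pose f (t : R) : R := e * t - mills t.
have df (t : R) : is_derive t 1 f (e - (2 * t * mills t - 1)).
  have d1 : is_derive t 1 (fun t : R => e * t) _ :=
    is_deriveM (is_derive_cst e t 1) (is_derive_id t 1).
  have d2 : is_derive t 1 f _ := is_deriveB d1 (is_derive_mills t).
  by apply: (is_derive_eq d2); rewrite /GRing.scale/= mulr0 addr0 mulr1.
have : 0 <= e - (2 * s * mills s - 1).
  have [d <-] := df s; rewrite -derive1E.
  have := @incr_derive1_ge0 R f setT s; rewrite interiorT; apply => //.
  move=> x y _ _ xy; have := mills_le (ltW xy).
  by have : e * x < e * y by [rewrite ltr_pM2l|]; rewrite /f; lra.
lra.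
Qed.

(** With C = 2 mills 0, the function e^(-t^2) ((2t + C) mills t - 1) has derivative
e^(-t^2) (2 mills t - C), which is nonpositive for t >= 0, and is bounded below by
- e^(-t^2), which tends to 0.  Hence it is nonnegative, and at c this is the
claim. *)
Lemma mills_slope_le c : 0 <= c -> mills_slope c <= 2 * mills 0 * mills c.
Proof.
move=> c0; pose C := 2 * mills 0.
pose f (t : R) : R := expR (- t ^+ 2) * ((2 * t + C) * mills t - 1).
have df (t : R) : is_derive t 1 f (expR (- t ^+ 2) * (2 * mills t - C)).
  have d0 : is_derive t 1 (fun t : R => - t ^+ 2) (- (t *+ 2)).
    have e : is_derive t 1 (fun s : R => s ^+ 2) _ := is_deriveX 2 (is_derive_id t 1).
    have e' : is_derive t 1 (fun s : R => - s ^+ 2) _ := is_deriveN e.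
    by apply: (is_derive_eq e'); rewrite /GRing.scale/= expr1 mulr1 mulr_natl.
  have d1 : is_derive t 1 (fun t : R => expR (- t ^+ 2)) (expR (- t ^+ 2) * (- (t *+ 2))).
    by apply: is_derive1_comp.
  have d2 : is_derive t 1 (fun t : R => 2 * t + C) 2.
    have e : is_derive t 1 (fun t : R => 2 * t + C) _ :=
      is_deriveD (is_deriveM (is_derive_cst (2 : R) t 1) (is_derive_id t 1)) (is_derive_cst C t 1).
    by apply: (is_derive_eq e); rewrite /GRing.scale/= mulr0 !addr0 mulr1.
  have d3 : is_derive t 1 (fun t : R => (2 * t + C) * mills t - 1) _ :=
    is_deriveB (is_deriveM d2 (is_derive_mills t)) (is_derive_cst (1 : R) t 1).
  have d4 : is_derive t 1 f _ := is_deriveM d1 d3.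
  apply: (is_derive_eq d4); rewrite /GRing.scale/= -mulr_natr.
  move: (expR _) (mills t) => x m; ring.
have f_ge t : c <= t -> - expR (- t ^+ 2) <= f c.
  move=> ct; apply: (@le_trans _ _ (f t)).
    rewrite /f mulrBr mulr1 lerBrDr addrC subrr; apply: mulr_ge0; first exact: expR_ge0.
    apply: mulr_ge0; last exact/ltW/mills_gt0.
    have t0 : 0 <= t by exact: le_trans ct.
    have M0 := mills_gt0 0.
    by rewrite addr_ge0// mulr_ge0// ltW.
  apply: (@ler0_derive1_nincr R f c t) => //.
  - move=> x; rewrite in_itv/= => /andP[cx _]; rewrite derive1E.
    have [_ ->] := df x; apply: mulr_ge0_le0; first exact: expR_ge0.
    by rewrite subr_le0 /C ler_pM2l// mills_le// (le_trans c0)// ltW.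
  - by apply: derivable_within_continuous => x _; have [] := df x.
have : 0 <= f c.
  have lim : - expR (- t ^+ 2) @[t --> +oo] --> (0 : R).
    by rewrite -oppr0; apply: cvgN; exact: cvg_gauss_fun.
  apply: (ler_cvg_to lim (cvg_cst (f c))).
  by near=> t; apply: f_ge; near: t; apply: nbhs_pinfty_ge; exact: num_real.
by rewrite pmulr_rge0 ?expR_gt0// subr_ge0 /mills_slope -/C; lra.
Unshelve. all: by end_near. Qed.

End Mills.

(** * Quotients of Mills ratios *)

Section Key.
Context (R : realType).
Implicit Types (a c : R).
Local Notation mills := (@mills R).
Local Notation mills_slope := (@mills_slope R).

Definition mills_cst : R := 2 * mills 0 + (mills 0)^-1.

Lemma mills_cst_ge0 : 0 <= mills_cst.
Proof.
have m0 := mills_gt0 (0 : R).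
have i0 : 0 < (mills 0)^-1 by rewrite invr_gt0.
by rewrite /mills_cst; lra.
Qed.

(** For c >= 0 the numerator is at most a multiple of mills c, by [mills_slope_le].
For c < 0 the difference equals (1 + 2c mills a) / (mills a + mills c).  There
a >= - c > 0 and 2a mills a <= 1, so the numerator lies between 0 and 1, while
the denominator is at least mills 0. *)
Lemma mills_quotient a c : 0 <= a + c ->
  `|mills_slope c / (mills a + mills c) - 2 * Num.max (- c) 0| <= mills_cst.
Proof.
move=> ac; rewrite /mills_cst.
have ha := mills_gt0 a; have hc := mills_gt0 c; have h0 := mills_gt0 (0 : R).
have i0 : 0 < (mills 0)^-1 by rewrite invr_gt0.
have D0 : 0 < mills a + mills c by rewrite addr_gt0.
have [c0|c0] := leP 0 c.
  have -> : Num.max (- c) 0 = 0 by apply/max_idPr; rewrite oppr_le0.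
  have s0 := mills_slope_ge0 c; have s1 := mills_slope_le c0.
  have N0 : 0 <= mills_slope c / (mills a + mills c) by rewrite divr_ge0// ltW.
  rewrite mulr0 subr0 ger0_norm//.
  rewrite ler_pdivrMr//; apply: (le_trans s1).
  have p1 : 0 < 2 * mills 0 * mills a by do 2 apply: mulr_gt0 => //.
  have p2 : 0 < (mills 0)^-1 * (mills a + mills c) by rewrite mulr_gt0.
  by rewrite mulrDl mulrDr; lra.
have -> : Num.max (- c) 0 = - c by apply/max_idPl; rewrite oppr_ge0 ltW.
have -> : mills_slope c / (mills a + mills c) - 2 * - c =
    (1 + 2 * c * mills a) / (mills a + mills c).
  by rewrite /mills_slope; field; rewrite gt_eqF.
have sa := mills_slope_ge0 a; rewrite /mills_slope in sa.
have a0 : 0 < a by lra.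
have n0 : 0 <= 1 + 2 * c * mills a.
  have : 0 <= (a + c) * mills a by apply: mulr_ge0 => //; exact: ltW.
  lra.
have N0 : 0 <= (1 + 2 * c * mills a) / (mills a + mills c) by rewrite divr_ge0// ltW.
rewrite ger0_norm// ler_pdivrMr//.
have h0c : mills 0 <= mills c by apply: mills_le; exact: ltW.
have c_a : c * mills a < 0 by rewrite pmulr_llt0.
apply: (@le_trans _ _ 1); first by lra.
rewrite mulrDl -[leLHS](@mulVf _ (mills 0)) ?gt_eqF//.
have p1 : 0 < 2 * mills 0 * (mills a + mills c) by do 2 apply: mulr_gt0 => //.
have p2 : (mills 0)^-1 * mills 0 <= (mills 0)^-1 * (mills a + mills c).
  by rewrite ler_pM2l//; lra.
lra.
Qed.

Lemma mills_quotientC a c : 0 <= a + c ->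
  `|mills_slope a / (mills a + mills c) - 2 * Num.max (- a) 0| <= mills_cst.
Proof. by rewrite addrC => /mills_quotient; rewrite [mills c + _]addrC. Qed.

(** If a >= 0, then mills_slope a <= 1 and the denominator is at least
mills (a + c).  If a < 0, the denominator is at least mills 0 and
mills_slope a / (mills a + mills c) exceeds 1 / (mills a + mills c) by at most
- 2a <= 2c, while 2c mills c <= 1.  The bound depends on a + c, and so on the viscosity: it
serves for local integrability, not for the limit. *)
Lemma mills_correction a c : 0 <= a + c ->
  mills c * mills_slope a / (mills a + mills c) ^+ 2 <=
    (mills 0)^-1 + (mills 0)^-1 + (mills (a + c))^-1.
Proof.
move=> ac.
have ha := mills_gt0 a; have hc := mills_gt0 c; have h0 := mills_gt0 (0 : R).
have hac := mills_gt0 (a + c).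
have i0 : 0 < (mills 0)^-1 by rewrite invr_gt0.
have iac : 0 < (mills (a + c))^-1 by rewrite invr_gt0.
set D := mills a + mills c.
have D0 : 0 < D by rewrite addr_gt0.
rewrite expr2 -mulf_div.
have cD : mills c / D <= 1 by rewrite ler_pdivrMr// mul1r lerDr ltW.
have cD0 : 0 <= mills c / D by rewrite divr_ge0// ltW.
have sD0 : 0 <= mills_slope a / D by rewrite divr_ge0 ?mills_slope_ge0// ltW.
have [a0|a0] := leP 0 a.
  apply: (@le_trans _ _ (mills (a + c))^-1); last by lra.
  apply: (@le_trans _ _ (mills_slope a / D)); first by rewrite ler_piMl.
  rewrite ler_pdivrMr//; apply: (@le_trans _ _ 1).
    by rewrite /mills_slope lerBlDr lerDl; apply: mulr_ge0; lra.
  rewrite -[leLHS](@mulVf _ (mills (a + c))) ?gt_eqF// ler_pM2l//.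
  have : mills (a + c) <= mills c by apply: mills_le; rewrite lerDr.
  by rewrite /D; lra.
have sc := mills_slope_ge0 c; rewrite /mills_slope in sc.
have h0a : mills 0 <= mills a by apply: mills_le; exact: ltW.
have iD : D^-1 <= (mills 0)^-1 by rewrite lef_pV2 ?posrE// /D; lra.
have E : mills_slope a / D = D^-1 + 2 * (- a) * (mills a / D).
  by rewrite /mills_slope; field; rewrite gt_eqF.
have aD : mills a / D <= 1 by rewrite ler_pdivrMr// mul1r lerDl ltW.
have aD0 : 0 <= mills a / D by rewrite divr_ge0// ltW.
apply: (@le_trans _ _ (mills c / D * (D^-1 + 2 * c))).
  rewrite ler_wpM2l// E lerD2l.
  apply: (@le_trans _ _ (2 * (- a) * 1)); first by rewrite ler_wpM2l//; lra.
  by lra.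
rewrite mulrDr; apply: (@le_trans _ _ ((mills 0)^-1 + (mills 0)^-1)); last by lra.
apply: lerD.
  by apply: le_trans iD; rewrite ler_piMl// invr_ge0 ltW.
apply: le_trans iD; rewrite mulrAC ler_piMl//; first by rewrite invr_ge0 ltW.
lra.
Qed.

End Key.

(** * The viscous profiles at a fixed time *)

Section Viscous.
Context (R : realType).
Local Notation mu := (@lebesgue_measure R).
Local Notation mills := (@mills R).
Local Notation mills_slope := (@mills_slope R).
Implicit Types (x v y : R).
Variables (eps B : R).
Hypotheses (eps0 : 0 < eps) (B0 : 0 < B).

(** The length scale of the viscous layers. *)
Definition width : R := Num.sqrt (eps * B).
Local Notation k := width.

Lemma width_gt0 : 0 < k. Proof. by rewrite sqrtr_gt0 mulr_gt0. Qed.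

Lemma width_sqr : k * k = eps * B.
Proof. by rewrite -expr2 sqr_sqrtr// ltW// mulr_gt0. Qed.

(** Completion of the square in y: the exponent becomes that of a Gaussian centred
at x - v * B, the foot of the characteristic of speed v through x. *)
Lemma visc_integrandE v x y :
  visc_integrand eps B v x y =
  expR (((x - v * B) ^+ 2 - x ^+ 2) / (4 * eps * B)) *
    gauss_fun ((y - (x - v * B)) / (2 * k)).
Proof.
rewrite /visc_integrand /gauss_fun -expRD; congr expR.
have -> : ((y - (x - v * B)) / (2 * k)) ^+ 2 = (y - (x - v * B)) ^+ 2 / (4 * eps * B).
  rewrite expr_div_n; congr (_ / _).
  by rewrite -mulrA -width_sqr; ring.
by field; rewrite !gt_eqF.
Qed.

Lemma bmE v x : bm eps B v x =
  (Num.sqrt pi)^-1 * expR (- (x ^+ 2 / (4 * eps * B))) * mills ((x - v * B) / (2 * k)).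
Proof.
have k0 := width_gt0.
have k2 : 0 < 2 * k by rewrite mulr_gt0.
rewrite /bm.
have -> : Num.sqrt (4 * pi * eps * B) = 2 * k * Num.sqrt pi.
  have -> : 4 * pi * eps * B = (2 * k) ^+ 2 * pi.
    by rewrite expr2 mulrACA width_sqr; ring.
  by rewrite sqrtrM ?sqr_ge0// sqrtr_sqr ger0_norm// ltW.
have -> : \int[mu]_(y in `]-oo, 0]) visc_integrand eps B v x y =
    expR (((x - v * B) ^+ 2 - x ^+ 2) / (4 * eps * B)) *
        (2 * k * gauss_tail (- (x - v * B) / (2 * k))).
  rewrite /Rintegral.
  under eq_integral do rewrite visc_integrandE EFinM.
  rewrite ge0_integralZl//=.
  - by rewrite gauss_tail_affine.
  - apply/measurable_EFinP; apply: measurable_funTS; apply: continuous_measurable_fun => y.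
    apply: (@continuous_comp _ _ _ (fun y => (y - (x - v * B)) / (2 * k)) (@gauss_fun R));
      last exact: continuous_gauss_fun.
    by apply: cvgM; [apply: cvgB; [exact: cvg_id|exact: cvg_cst]|exact: cvg_cst].
  - by move=> y _; rewrite lee_fin gauss_fun_ge0.
rewrite /mills mulNr.
have -> : ((x - v * B) / (2 * k)) ^+ 2 = (x - v * B) ^+ 2 / (4 * eps * B).
  by rewrite expr_div_n; congr (_ / _); rewrite -mulrA -width_sqr; ring.
have sp : 0 < Num.sqrt pi :> R by rewrite sqrtr_gt0 pi_gt0.
rewrite mulrBl expRD mulrAC -!mulrA; move: (expR _) (expR _) (gauss_tail _) => e1 e2 g.
by field; rewrite !gt_eqF.
Qed.

(** The reflection y |-> - y exchanges the two half lines and changes the signs of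
x and v, which reduces the claim to [bmE]. *)
Lemma bpE v x : bp eps B v x =
  (Num.sqrt pi)^-1 * expR (- (x ^+ 2 / (4 * eps * B))) * mills (- ((x - v * B) / (2 * k))).
Proof.
have -> : bp eps B v x = bm eps B (- v) (- x).
  rewrite /bp /bm; congr (_ * _).
  rewrite /Rintegral (@ge0_integration_by_substitution0 R
      (fun y => (visc_integrand eps B v x y)%:E)).
  - congr fine; apply: eq_integral => y _; congr (_%:E).
    rewrite /visc_integrand; congr expR.
    by congr (- (_ / _) - _ / _); ring.
  - apply/measurable_EFinP; apply: continuous_measurable_fun => y.
    apply: (@continuous_comp _ _ _
        (fun y => - ((x - y) ^+ 2 / (4 * eps * B)) - v * y / (2 * eps)) expR);
          last exact: continuous_expR.
    apply: cvgB.
      apply: cvgN; apply: cvgM; last exact: cvg_cst.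
      apply: (@continuous_comp _ _ _ (fun y => x - y) (fun z => z ^+ 2));
        last exact: exprn_continuous.
      by apply: cvgB; [exact: cvg_cst|exact: cvg_id].
    by apply: cvgM; [apply: cvgM; [exact: cvg_cst|exact: cvg_id]|exact: cvg_cst].
  - by move=> y; rewrite lee_fin expR_ge0.
rewrite bmE sqrrN; congr (_ * mills _).
by ring.
Qed.

Section Fixed.
Variables (rm rp um up : R).
Hypothesis um_le_up : um <= up.

(** The signed distances of x to the two fronts on the scale 2k, oriented so
that both are positive for x between the fronts; hence their sum is nonnegative. *)
Definition arg_m x : R := (x - um * B) / (2 * k).
Definition arg_p x : R := - ((x - up * B) / (2 * k)).

Lemma arg_sum x : arg_m x + arg_p x = (up - um) * B / (2 * k).
Proof. by rewrite /arg_m /arg_p; field; rewrite gt_eqF// width_gt0. Qed.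

Lemma arg_sum_ge0 x : 0 <= arg_m x + arg_p x.
Proof.
by rewrite arg_sum divr_ge0 ?mulr_ge0 ?subr_ge0// ltW// ?width_gt0.
Qed.

Definition mills_sum x : R := mills (arg_m x) + mills (arg_p x).

Lemma mills_sum_gt0 x : 0 < mills_sum x.
Proof. by rewrite addr_gt0// mills_gt0. Qed.

Let Gx x : R := (Num.sqrt pi)^-1 * expR (- (x ^+ 2 / (4 * eps * B))).
Let Gx0 x : 0 < Gx x.
Proof. by rewrite mulr_gt0 ?expR_gt0// invr_gt0 sqrtr_gt0 pi_gt0. Qed.

(** The Gaussian factor of [bmE] and [bpE] is also the one in the last term of
W_visc, so it cancels. *)
Lemma W_viscE x : W_visc eps B rm rp um up x =
  k * (rp * mills_slope (arg_p x) - rm * mills_slope (arg_m x)) / mills_sum x.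
Proof.
have k0 := width_gt0; have D0 := mills_sum_gt0 x; have G0 := Gx0 x.
have p0 : 0 < Num.sqrt pi :> R by rewrite sqrtr_gt0 pi_gt0.
rewrite /W_visc bmE bpE -/(arg_m x) -/(arg_p x) -/(Gx x) -/width.
have -> : expR (- (x ^+ 2 / (4 * eps * B))) = Num.sqrt pi * Gx x.
  by rewrite /Gx mulrA divff ?mul1r// gt_eqF.
have -> : x - um * B = 2 * k * arg_m x by rewrite /arg_m; field; rewrite gt_eqF.
have -> : x - up * B = - (2 * k * arg_p x).
  by rewrite /arg_p; field; rewrite gt_eqF.
move: D0; rewrite /mills_sum /mills_slope.
move: G0 (mills (arg_m x)) (mills (arg_p x)) (arg_m x) (arg_p x) => + ma mp a c.
move: (Gx x) (Num.sqrt pi) p0 (k) k0 => g p p0 q q0 g0 D0.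
field.
by rewrite -mulrDr mulf_neq0 ?gt_eqF.
Qed.

(** A primitive of the limit density in x, vanishing between the fronts. *)
Definition W_lim x : R := rp * Num.max (x - up * B) 0 - rm * Num.max (um * B - x) 0.

(** In terms of arg_m and arg_p, W_lim is k times the same combination as W_visc in
which the quotients of [mills_quotient] are replaced by their approximations. *)
Lemma W_visc_dist x :
  `|W_visc eps B rm rp um up x - W_lim x| <= k * ((`|rp| + `|rm|) * mills_cst R).
Proof.
have k0 := width_gt0; have D0 := mills_sum_gt0 x.
have k2 : 0 < 2 * k by rewrite mulr_gt0.
have maxE (y z : R) : y = 2 * k * z -> Num.max y 0 = k * (2 * Num.max z 0).
  by move=> ->; rewrite mulrCA mulrA maxr_pMr ?mulr0// ltW.
rewrite W_viscE /W_lim (@maxE (x - up * B) (- arg_p x)); last first.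
  by rewrite /arg_p; field; rewrite gt_eqF.
rewrite (@maxE (um * B - x) (- arg_m x)); last first.
  by rewrite /arg_m; field; rewrite gt_eqF.
have qp := mills_quotient (arg_sum_ge0 x).
have qm := mills_quotientC (arg_sum_ge0 x).
rewrite -/(mills_sum x) in qp qm.
have -> : k * (rp * mills_slope (arg_p x) - rm * mills_slope (arg_m x)) / mills_sum x -
   (rp * (k * (2 * Num.max (- arg_p x) 0)) - rm * (k * (2 * Num.max (- arg_m x) 0))) =
   k * (rp * (mills_slope (arg_p x) / mills_sum x - 2 * Num.max (- arg_p x) 0) -
        rm * (mills_slope (arg_m x) / mills_sum x - 2 * Num.max (- arg_m x) 0)) by ring.
rewrite normrM ger0_norm ?ler_pM2l//; last exact: ltW.
apply: (le_trans (ler_normB _ _)); rewrite !normrM [leRHS]mulrDl.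
by apply: lerD; apply: ler_wpM2l.
Qed.

Definition U_visc x : R :=
  (up * bp eps B up x + um * bm eps B um x) / (bp eps B up x + bm eps B um x).

Lemma U_viscE x : U_visc x =
  (up * mills (arg_p x) + um * mills (arg_m x)) / mills_sum x.
Proof.
have D0 := mills_sum_gt0 x; have G0 := Gx0 x.
rewrite /U_visc bmE bpE -/(arg_m x) -/(arg_p x) -/(Gx x).
move: D0; rewrite /mills_sum.
move: (Gx x) G0 => g g0 D0.
field.
by rewrite -mulrDr mulf_neq0 ?gt_eqF// addrC.
Qed.

Lemma U_visc_bound x : um <= U_visc x <= up.
Proof.
have D0 := mills_sum_gt0 x.
rewrite U_viscE ler_pdivlMr// ler_pdivrMr// /mills_sum.
have hm := mills_gt0 (arg_m x); have hp := mills_gt0 (arg_p x).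
have dp : 0 <= (up - um) * mills (arg_p x) by apply: mulr_ge0; [rewrite subr_ge0|exact: ltW].
have dm : 0 <= (up - um) * mills (arg_m x) by apply: mulr_ge0; [rewrite subr_ge0|exact: ltW].
by apply/andP; split; lra.
Qed.

(** Expressing um and up through arg_m and arg_p gives
U = x / B - (k / B) * (q_p - q_m) with the two quotients of [mills_quotient], and
the limit has the same form with the approximations of these quotients. *)
Lemma U_visc_dist x :
  `|U_visc x - riemann_u um up x B| <= k / B * (2 * mills_cst R).
Proof.
have k0 := width_gt0; have D0 := mills_sum_gt0 x.
have Bn0 : B != 0 by rewrite gt_eqF.
have kn0 : k != 0 by rewrite gt_eqF.
have Dn0 : mills_sum x != 0 by rewrite gt_eqF.
have UE : U_visc x = x / B - k / B *
    (mills_slope (arg_p x) / mills_sum x - mills_slope (arg_m x) / mills_sum x).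
  rewrite U_viscE /mills_slope.
  have -> : up = x / B + 2 * k * arg_p x / B by rewrite /arg_p; field; rewrite kn0 Bn0.
  have -> : um = x / B - 2 * k * arg_m x / B by rewrite /arg_m; field; rewrite kn0 Bn0.
  rewrite /mills_sum in Dn0 *.
  move: (mills (arg_m x)) (mills (arg_p x)) (arg_m x) (arg_p x) Dn0 => ma mp a c Dn0.
  by field; rewrite Dn0 Bn0.
have umb : um * B <= up * B by rewrite ler_pM2r.
have rE : riemann_u um up x B = x / B - k / B *
    (2 * Num.max (- arg_p x) 0 - 2 * Num.max (- arg_m x) 0).
  have pE : - arg_p x = (x - up * B) / (2 * k) by rewrite /arg_p opprK.
  have mE : - arg_m x = (um * B - x) / (2 * k) by rewrite /arg_m; field.
  have i0 : 0 < (2 * k)^-1 by rewrite invr_gt0 mulr_gt0.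
  rewrite pE mE /riemann_u.
  have [x1|x1] := ltP x (um * B).
    have -> : Num.max ((x - up * B) / (2 * k)) 0 = 0.
      by apply/max_idPr; rewrite pmulr_lle0// subr_le0 (le_trans (ltW x1)).
    have -> : Num.max ((um * B - x) / (2 * k)) 0 = (um * B - x) / (2 * k).
      by apply/max_idPl; rewrite pmulr_lge0// subr_ge0 ltW.
    by field; rewrite kn0 Bn0.
  have -> : Num.max ((um * B - x) / (2 * k)) 0 = 0.
    by apply/max_idPr; rewrite pmulr_lle0// subr_le0.
  have [x2|x2] := leP (up * B) x.
    have -> : Num.max ((x - up * B) / (2 * k)) 0 = (x - up * B) / (2 * k).
      by apply/max_idPl; rewrite pmulr_lge0// subr_ge0.
    by field; rewrite kn0 Bn0.
  have -> : Num.max ((x - up * B) / (2 * k)) 0 = 0.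
    by apply/max_idPr; rewrite pmulr_lle0// subr_le0 ltW.
  by ring.
have qp := mills_quotient (arg_sum_ge0 x).
have qm := mills_quotientC (arg_sum_ge0 x).
rewrite -/(mills_sum x) in qp qm.
rewrite UE rE.
move: qp qm; move: (mills_slope (arg_p x) / _) (mills_slope (arg_m x) / _) => q1 q2 qp qm.
have -> : forall q q' m m' : R, x / B - k / B * (q - q') - (x / B - k / B * (m - m')) =
    k / B * ((q' - m') - (q - m)) by move=> *; ring.
rewrite normrM ger0_norm; last by rewrite divr_ge0// ltW.
rewrite ler_pM2l ?divr_gt0// [leRHS]mulr_natl mulr2n.
by apply: (le_trans (ler_normB _ _)); exact: lerD.
Qed.

(** The x-derivative of W_visc: a weighted mean of the two densities minus a
correction that compensates it in the vacuum between the fronts. *)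
Definition rho_visc_formula x : R :=
  (rm * mills (arg_m x) + rp * mills (arg_p x)) / mills_sum x -
  (arg_m x + arg_p x) * (rm * (mills (arg_p x) * mills_slope (arg_m x) / mills_sum x ^+ 2) +
     rp * (mills (arg_m x) * mills_slope (arg_p x) / mills_sum x ^+ 2)).

Lemma is_derive_mills_slope (s : R) :
  is_derive s 1 mills_slope (2 * s * mills_slope s - 2 * mills s).
Proof.
have d2 : is_derive s 1 (fun s : R => 2 * s) 2.
  have e : is_derive s 1 (fun s : R => 2 * s) _ :=
    is_deriveM (is_derive_cst (2 : R) s 1) (is_derive_id s 1).
  by apply: (is_derive_eq e); rewrite /GRing.scale/= mulr0 addr0 mulr1.
have e : is_derive s 1 mills_slope _ :=
  is_deriveB (is_derive_cst (1 : R) s 1) (is_deriveM d2 (is_derive_mills s)).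
by apply: (is_derive_eq e); rewrite /GRing.scale/= /mills_slope; ring.
Qed.

Lemma is_derive_arg_m x : is_derive x 1 arg_m (2 * k)^-1.
Proof.
have e : is_derive x 1 arg_m _ :=
  is_deriveM (is_deriveB (is_derive_id x 1) (is_derive_cst (um * B) x 1))
      (is_derive_cst (2 * k)^-1 x 1).
by apply: (is_derive_eq e); rewrite /GRing.scale/= subr0 mulr1 mulr0 add0r.
Qed.

Lemma is_derive_arg_p x : is_derive x 1 arg_p (- (2 * k)^-1).
Proof.
have e : is_derive x 1 arg_p _ := is_deriveN
  (is_deriveM (is_deriveB (is_derive_id x 1) (is_derive_cst (up * B) x 1))
      (is_derive_cst (2 * k)^-1 x 1)).
by apply: (is_derive_eq e); rewrite /GRing.scale/= subr0 mulr1 mulr0 add0r.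
Qed.

Lemma is_derive_W_visc x :
  is_derive x 1 (W_visc eps B rm rp um up) (rho_visc_formula x).
Proof.
have -> : W_visc eps B rm rp um up = fun x =>
    k * (rp * mills_slope (arg_p x) - rm * mills_slope (arg_m x)) / mills_sum x.
  by apply/funext => y; rewrite W_viscE.
have k0 := width_gt0; have D0 := mills_sum_gt0 x.
have kn0 : k != 0 by rewrite gt_eqF.
have Dn0 : mills_sum x != 0 by rewrite gt_eqF.
have dm := is_derive_arg_m x; have dp := is_derive_arg_p x.
have d1 : is_derive x 1 (fun x => mills_slope (arg_p x)) _ :=
  is_derive1_comp (is_derive_mills_slope (arg_p x)) dp.
have d2 : is_derive x 1 (fun x => mills_slope (arg_m x)) _ :=
  is_derive1_comp (is_derive_mills_slope (arg_m x)) dm.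
have d3 : is_derive x 1 (fun x => mills (arg_p x)) _ :=
  is_derive1_comp (is_derive_mills (arg_p x)) dp.
have d4 : is_derive x 1 (fun x => mills (arg_m x)) _ :=
  is_derive1_comp (is_derive_mills (arg_m x)) dm.
have d5 : is_derive x 1 (fun x => rp * mills_slope (arg_p x) - rm * mills_slope (arg_m x)) _ :=
  is_deriveB (is_deriveM (is_derive_cst rp x 1) d1) (is_deriveM (is_derive_cst rm x 1) d2).
have d6 : is_derive x 1 (fun x => k * (rp * mills_slope (arg_p x) - rm * mills_slope (arg_m x)))
    _ :=
  is_deriveM (is_derive_cst k x 1) d5.
have d7 : is_derive x 1 mills_sum _ := is_deriveD d4 d3.
have d8 := is_deriveV Dn0 d7.
have d9 : is_derive x 1 (fun x =>
    k * (rp * mills_slope (arg_p x) - rm * mills_slope (arg_m x)) / mills_sum x) _ :=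
  is_deriveM d6 d8.
apply: (is_derive_eq d9).
rewrite /rho_visc_formula /GRing.scale/= !mulr0 !addr0.
have -> : mills_slope (arg_m x) = 1 - 2 * arg_m x * mills (arg_m x) by [].
have -> : mills_slope (arg_p x) = 1 - 2 * arg_p x * mills (arg_p x) by [].
rewrite /mills_sum in Dn0 *.
move: (mills (arg_m x)) (mills (arg_p x)) (arg_m x) (arg_p x) Dn0 => ma mp a c Dn0.
move: (k) kn0 => q q0.
by field; rewrite ?q0 ?Dn0.
Qed.

Lemma rho_visc_formula_bound x : 0 <= rm -> 0 <= rp ->
  `|rho_visc_formula x| <= (rm + rp) * (1 + (up - um) * B / (2 * k) *
    ((mills 0)^-1 + (mills 0)^-1 + (mills ((up - um) * B / (2 * k)))^-1)).
Proof.
move=> rm0 rp0; rewrite -(arg_sum x) /rho_visc_formula.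
have D0 := mills_sum_gt0 x.
have ac := arg_sum_ge0 x.
have ha := mills_gt0 (arg_m x); have hc := mills_gt0 (arg_p x).
have q1 := mills_correction ac.
have q2 := @mills_correction R (arg_p x) (arg_m x).
rewrite [arg_p x + _]addrC in q2; have {}q2 := q2 ac.
rewrite [mills (arg_p x) + _]addrC in q2.
rewrite -/(mills_sum x) in q1 q2.
have n1 : 0 <= mills (arg_p x) * mills_slope (arg_m x) / mills_sum x ^+ 2.
  by rewrite divr_ge0 ?sqr_ge0// mulr_ge0 ?mills_slope_ge0// ltW.
have n2 : 0 <= mills (arg_m x) * mills_slope (arg_p x) / mills_sum x ^+ 2.
  by rewrite divr_ge0 ?sqr_ge0// mulr_ge0 ?mills_slope_ge0// ltW.
have a1 : (rm * mills (arg_m x) + rp * mills (arg_p x)) / mills_sum x <= rm + rp.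
  rewrite ler_pdivrMr// /mills_sum.
  have e1 : 0 <= rm * mills (arg_p x) by rewrite mulr_ge0// ltW.
  have e2 : 0 <= rp * mills (arg_m x) by rewrite mulr_ge0// ltW.
  lra.
have a0 : 0 <= (rm * mills (arg_m x) + rp * mills (arg_p x)) / mills_sum x.
  apply: divr_ge0; last exact: ltW.
  by apply: addr_ge0; apply: mulr_ge0 => //; exact: ltW.
move: q1 q2 n1 n2 a1 a0 ac.
move: (_ / _ ^+ 2) (mills (arg_m x) * _ / _) (_ / mills_sum x) (arg_m x + arg_p x) => y1 y2 y3 y4.
move: (_ + _ + _^-1) => K q1 q2 n1 n2 a1 a0 ac.
have b0 : 0 <= y4 * (rm * y1 + rp * y2) by rewrite mulr_ge0 ?addr_ge0 ?mulr_ge0.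
have b1 : y4 * (rm * y1 + rp * y2) <= y4 * ((rm + rp) * K).
  by rewrite ler_wpM2l// mulrDl lerD// ler_wpM2l.
rewrite ler_norml; apply/andP; split; lra.
Qed.

End Fixed.

End Viscous.

(** * Integration by parts for piecewise smooth primitives *)

Section MorePrimitives.
Context (R : realType).
Local Notation mu := (@lebesgue_measure R).
Implicit Types (F G f g : R -> R) (a b c z : R).

Lemma primitive_lin (a b c c' : R) F f G g : primitive a b F f -> primitive a b G g ->
  primitive a b (fun x => c * F x + c' * G x) (fun x => c * f x + c' * g x).
Proof.
move=> [fi Ff] [gi Gg].
have h1 := integrableZ_itv c fi; have h2 := integrableZ_itv c' gi.
split; first exact: integrableD_itv.
move=> s t as_ st tb.
have sub : `[s, t] `<=` `[a, b] by apply: subset_itv; rewrite bnd_simp.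
have is_ (h : R -> R) : mu.-integrable `[a, b] (EFin \o h) -> mu.-integrable `[s, t] (EFin \o h).
  by apply: integrableS.
rewrite RintegralD//; [|exact: is_|exact: is_].
rewrite !RintegralZl//; [|exact: is_|exact: is_].
by rewrite -Ff// -Gg//; ring.
Qed.

Lemma primitive_of_derive (a b : R) F f : (forall x : R, is_derive x 1 F (f x)) ->
  continuous f -> primitive a b F f.
Proof.
move=> dF cf; split.
  have := integrable_continuousM cf (primitive_id a b).1.
  by apply: eq_integrable => // x _ /=; rewrite mulr1.
move=> s t _ st _; move: st; rewrite le_eqVlt => /predU1P[->|st].
  by rewrite subrr set_itv1 Rintegral_set1.
have cF : continuous F.
  move=> x; apply: differentiable_continuous; apply/derivable1_diffP.
  by have [] := dF x.
rewrite /Rintegral (@continuous_FTC2 R f F s t)//.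
- exact: continuous_subspaceT.
- split; first by move=> x _; have [] := dF x.
  + by apply: cvg_at_right_filter; exact: cF.
  + by apply: cvg_at_left_filter; exact: cF.
- by move=> x _; rewrite derive1E; have [] := dF x.
Qed.

Lemma primitive_pospart (a b z : R) :
  primitive a b (fun x => Num.max (x - z) 0) (fun x => if z <= x then 1 else 0).
Proof.
have -> : (fun x : R => if z <= x then 1 else 0 : R) = \1_`[z, +oo[.
  by apply/funext => x; rewrite indicE mem_setE in_itv/= andbT; case: ifP.
have mI : measurable_fun setT (\1_`[z, +oo[ : R -> R) by exact: measurable_indic.
split.
  have bI : [bounded \1_`[z, +oo[ x : R | x in `[a, b]].
    exists 1; split; first exact: num_real.
    by move=> N N1 x _ /=; rewrite indicE; case: (_ \in _);
      rewrite ?normr1 ?normr0 ltW// (lt_trans ltr01).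
  have := @integrableMl _ _ _ mu `[a, b]%classic (measurable_itv _) _ _ (primitive_id a b).1
    (measurable_funTS mI) bI.
  by apply: eq_integrable => // x _ /=; rewrite mul1e.
move=> s t _ st _.
rewrite (_ : \1_`[z, +oo[ = (cst (1 : R)) \_ `[z, +oo[); last first.
  by apply/funext => x; rewrite patchE indicE; case: (_ \in _).
rewrite -Rintegral_mkcondr.
have [tz|zt] := ltP t z.
  rewrite (_ : _ `&` _ = set0) ?Rintegral_set0.
    have -> : Num.max (t - z) 0 = 0 by apply/max_idPr; lra.
    have -> : Num.max (s - z) 0 = 0 by apply/max_idPr; lra.
    by rewrite subrr.
  by apply/seteqP; split => x //=; rewrite !in_itv/= andbT => -[/andP[? ?] ?]; lra.
have -> : `[s, t] `&` `[z, +oo[ = `[Num.max s z, t]%classic.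
  apply/seteqP; split => x /=; rewrite !in_itv/= andbT ge_max.
    by move=> [/andP[-> ->] ->].
  by move=> /andP[/andP[-> ->] ->].
have [mx _] := primitive_id (Num.max s z) t.
have [_ /(_ (Num.max s z) t (lexx _) _ (lexx _)) E] := primitive_id (Num.max s z) t.
have -> : Num.max (t - z) 0 = t - z by apply/max_idPl; rewrite subr_ge0.
rewrite -E; last by rewrite ge_max st zt.
have -> : Num.max (s - z) 0 = Num.max s z - z.
  have [sz|zs] := leP s z; first by rewrite subrr; apply/max_idPr; rewrite subr_le0.
  by apply/max_idPl; rewrite subr_ge0 ltW.
by ring.
Qed.

Definition mul_pair (p : R * R) : R := p.1 * p.2.

Let is_derive_mulr (c x : R) : is_derive x 1 (fun y => y * c : R) c.
Proof.
have e : is_derive x 1 (fun y => y * c : R) _ :=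
  is_deriveM (is_derive_id x 1) (is_derive_cst c x 1).
by apply: (is_derive_eq e); rewrite scaler0 add0r /GRing.scale/= mulr1.
Qed.

Let is_derive_mull (c x : R) : is_derive x 1 (fun y => c * y : R) c.
Proof.
have e : is_derive x 1 (fun y => c * y : R) _ :=
  is_deriveM (is_derive_cst c x 1) (is_derive_id x 1).
by apply: (is_derive_eq e); rewrite scaler0 addr0 /GRing.scale/= mulr1.
Qed.

Lemma dx_mul_pair : dx mul_pair = snd.
Proof.
by apply/funext => p; rewrite /dx derive1E; have [] := is_derive_mulr p.2 p.1.
Qed.

Lemma dt_mul_pair : dt mul_pair = fst.
Proof.
by apply/funext => p; rewrite /dt derive1E; have [] := is_derive_mull p.1 p.2.
Qed.

Lemma Ck1_mul_pair : Ck 1 mul_pair.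
Proof.
split; first by move=> p; apply: cvgM; [exact: cvg_fst|exact: cvg_snd].
split.
- by move=> p; have [] := is_derive_mulr p.2 p.1.
- by move=> p; have [] := is_derive_mull p.1 p.2.
- by rewrite dx_mul_pair; split => // p; exact: cvg_snd.
- by rewrite dt_mul_pair; split => // p; exact: cvg_fst.
Qed.

(** The chain rule applied to a product. *)
Lemma primitive_by_parts a b F f G g : a <= b -> continuous F -> continuous G ->
  primitive a b F f -> primitive a b G g -> G a = 0 -> G b = 0 ->
  \int[mu]_(x in `[a, b]) (f x * G x) = - \int[mu]_(x in `[a, b]) (F x * g x).
Proof.
move=> ab cF cG pF pG Ga Gb.
have [_ /(_ a b (lexx _) ab (lexx _))] := primitive_comp2 Ck1_mul_pair cF cG pF pG.
rewrite dx_mul_pair dt_mul_pair /mul_pair/= Ga Gb !mulr0 subrr.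
have i1 : mu.-integrable `[a, b] (EFin \o (fun x => G x * f x)).
  exact: integrable_continuousM pF.1.
have i2 : mu.-integrable `[a, b] (EFin \o (fun x => F x * g x)).
  exact: integrable_continuousM pG.1.
rewrite RintegralD// => /esym/eqP; rewrite addr_eq0 => /eqP <-.
by apply: eq_Rintegral => x _; rewrite mulrC.
Qed.

End MorePrimitives.

(** * Convergence as the viscosity vanishes *)

Section Convergence.
Context (R : realType).
Local Notation mu := (@lebesgue_measure R).
Local Notation P := (measurableTypeR R * measurableTypeR R)%type.
Local Notation pm := (plane_measure R).
Variables (alpha sigma : R -> R) (rm rp um up : R).
Hypotheses (alpha_ge0 : {ae mu, forall t, 0 <= t -> 0 <= alpha t})
  (alpha_L1 : mu.-integrable `[0, +oo[ (EFin \o alpha))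
  (sigma_L1loc : L1loc_half_line sigma)
  (rm_gt0 : 0 < rm) (rp_gt0 : 0 < rp) (um_le_up : um <= up).
Let E := damping sigma.
Let b := beta alpha sigma.
Let B := Bint alpha sigma.
Let rho := rho_lim alpha sigma rm rp um up.
Let u := u_lim alpha sigma um up.

Let B_ge0 t : 0 <= B t. Proof. exact: Bint_ge0. Qed.
Let cB : continuous B. Proof. exact: continuous_Bint. Qed.
Let mB : measurable_fun setT (fun p : P => B p.2). Proof. exact: measurable_Bint. Qed.
Let cE : continuous E. Proof. exact: continuous_damping. Qed.

Lemma open_sub_closed_half_plane : @open_half_plane R `<=` @closed_half_plane R.
Proof. by move=> p; exact: ltW. Qed.

Let mwidth (eps : R) : measurable_fun setT (fun p : P => width eps (B p.2)).
Proof.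
apply: (measurableT_comp (f := fun t => width eps (B t))); last exact: measurable_snd_plane.
apply: continuous_measurable_fun => t.
apply: (@continuous_comp _ _ _ (fun t => eps * B t) Num.sqrt); last exact: sqrt_continuous.
by apply: cvgM; [exact: cvg_cst|exact: cB].
Qed.

Let mfront (v : R) : measurable_fun setT (fun p : P => p.1 - v * B p.2).
Proof. by apply: measurable_funB; [exact: measurable_fst_plane|apply: measurable_funM]. Qed.

Let marg (eps v : R) : measurable_fun setT
    (fun p : P => (p.1 - v * B p.2) / (2 * width eps (B p.2))).
Proof. by apply: measurable_fun_div => //; exact: measurable_funM. Qed.

Let margm (eps : R) : measurable_fun setT (fun p : P => arg_m eps (B p.2) um p.1).
Proof. exact: marg. Qed.

Let margp (eps : R) : measurable_fun setT (fun p : P => arg_p eps (B p.2) up p.1).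
Proof. by apply: measurable_funN; exact: marg. Qed.

Let mmills (f : P -> R) : measurable_fun setT f -> measurable_fun setT (fun p => mills (f p)).
Proof.
move=> mf; apply: (measurableT_comp (f := @mills R)) => //.
by apply: continuous_measurable_fun; exact: continuous_mills.
Qed.

Let mslope (f : P -> R) : measurable_fun setT f -> measurable_fun setT (fun p => mills_slope (f p)).
Proof.
move=> mf; apply: measurable_funB => //; apply: measurable_funM; last exact: mmills.
by apply: measurable_funM.
Qed.

Let msum (eps : R) : measurable_fun setT (fun p : P => mills_sum eps (B p.2) um up p.1).
Proof. by apply: measurable_funD; apply: mmills. Qed.

Let mdata (l r : R) : measurable_fun setT (fun p : P => riemann_data l r p.1).
Proof.
apply: measurable_fun_ifT => //.
by apply: measurable_fun_ltr; [exact: measurable_fst_plane|exact: measurable_cst].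
Qed.

Let mB0 : measurable_fun setT (fun p : P => B p.2 == 0).
Proof. by apply: measurable_fun_eqr. Qed.

Let B_pos (t : R) : B t != 0 -> 0 < B t.
Proof. by move=> Bn0; rewrite lt_neqAle eq_sym Bn0 B_ge0. Qed.

(** The viscous velocity before damping. *)
Definition u_profile (eps : R) (p : R * R) : R :=
  if B p.2 == 0 then riemann_data um up p.1 else U_visc eps (B p.2) um up p.1.

Lemma u_viscE eps x t : u_visc alpha sigma um up eps x t = u_profile eps (x, t) * E t.
Proof. by rewrite /u_visc /u_profile /=; case: ifP. Qed.

Lemma bounded_measurable_u_profile eps : 0 < eps ->
  measurable_fun setT (u_profile eps : P -> R) /\
  forall p, `|u_profile eps p| <= `|um| + `|up|.
Proof.
move=> eps0; split.
  have -> : u_profile eps = fun p => if B p.2 == 0 then riemann_data um up p.1 else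
     (up * mills (arg_p eps (B p.2) up p.1) + um * mills (arg_m eps (B p.2) um p.1)) /
       mills_sum eps (B p.2) um up p.1.
    apply/funext => p; rewrite /u_profile; case: eqP => // /eqP/B_pos Bp.
    by rewrite U_viscE.
  apply: measurable_fun_ifT => //; apply: measurable_fun_div => //.
  by apply: measurable_funD; apply: measurable_funM => //; exact: mmills.
move=> p; rewrite /u_profile; case: eqP => [_|/eqP/B_pos Bp].
  by rewrite /riemann_data; case: ifP => _; rewrite ?lerDl ?lerDr.
have /andP[h1 h2] := U_visc_bound eps0 Bp um_le_up p.1.
have /andP[? ?] := norm_bounds um; have /andP[? ?] := norm_bounds up.
by rewrite ler_norml; apply/andP; split; lra.
Qed.

Lemma L1loc_u_visc eps : 0 < eps ->
  L1loc (@open_half_plane R) (u_visc alpha sigma um up eps).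
Proof.
move=> eps0; have [mU UC] := bounded_measurable_u_profile eps0.
rewrite (_ : u_visc _ _ _ _ _ = fun x t => 1 * (u_profile eps (x, t) * E t)).
  apply: (L1loc_damped sigma_L1loc open_sub_closed_half_plane).
    exact: L1loc_half_line_cst.
  by split; [exact: mU|exists (`|um| + `|up|)].
by apply/funext => x; apply/funext => t; rewrite mul1r u_viscE.
Qed.

Lemma L1loc_u_lim : L1loc (@open_half_plane R) u.
Proof.
rewrite (_ : u = fun x t => 1 * (riemann_u um up x (B t) * E t)).
  apply: (@L1loc_damped R sigma sigma_L1loc _ _ (fun p => riemann_u um up p.1 (B p.2))
      open_sub_closed_half_plane).
    exact: L1loc_half_line_cst.
  exact: bounded_measurable_riemann_u.
by apply/funext => x; apply/funext => t; rewrite mul1r.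
Qed.

Lemma L1loc_rho_lim : L1loc (@open_half_plane R) rho.
Proof.
have [mr [C rC]] := bounded_measurable_rho rm rp um up alpha_L1 sigma_L1loc.
apply: (@L1loc_of_bound R _ _ _ (fun=> C) open_sub_closed_half_plane mr) => //.
  exact: L1loc_half_line_cst.
by move=> x t _; exact: rC (x, t).
Qed.

Definition rho_profile (eps : R) (p : R * R) : R :=
  if B p.2 == 0 then riemann_data rm rp p.1
  else rho_visc_formula eps (B p.2) rm rp um up p.1.

Lemma rho_viscE eps x t : 0 < eps ->
  rho_visc alpha sigma rm rp um up eps x t = rho_profile eps (x, t).
Proof.
move=> eps0; rewrite /rho_visc /rho_profile /=; case: eqP => // /eqP/B_pos Bp.
by rewrite derive1E; have [] := @is_derive_W_visc R eps (B t) eps0 Bp rm rp um up x.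
Qed.

Lemma measurable_rho_profile eps : measurable_fun setT (rho_profile eps : P -> R).
Proof.
apply: measurable_fun_ifT => //; apply: measurable_funB.
  apply: measurable_fun_div => //.
  by apply: measurable_funD; apply: measurable_funM => //; exact: mmills.
apply: measurable_funM; first exact: measurable_funD.
have m2 : measurable_fun setT (fun p : P => mills_sum eps (B p.2) um up p.1 ^+ 2).
  by apply: measurable_funM.
apply: measurable_funD; apply: measurable_funM => //; apply: measurable_fun_div => //.
  by apply: measurable_funM; [exact: mmills|exact: mslope].
by apply: measurable_funM; [exact: mmills|exact: mslope].
Qed.

(* This is arg_m + arg_p where B t > 0, in a form that stays continuous where B
   vanishes. *)
Let spread (eps t : R) : R := (up - um) * width eps (B t) / (2 * eps).
Let rho_bound (eps t : R) : R := (rm + rp) *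
  (1 + spread eps t * ((mills 0)^-1 + (mills 0)^-1 + (mills (spread eps t))^-1)).

Lemma rho_profile_bound eps p : 0 < eps -> `|rho_profile eps p| <= rho_bound eps p.2.
Proof.
move=> eps0; have eps2 : 0 < 2 * eps by rewrite mulr_gt0.
have s0 : 0 <= spread eps p.2.
  by rewrite divr_ge0 ?(ltW eps2)// mulr_ge0 ?subr_ge0// sqrtr_ge0.
have m0 := mills_gt0 (0 : R); have m1 := mills_gt0 (spread eps p.2).
rewrite /rho_profile; case: eqP => [_|/eqP/B_pos Bp].
  rewrite /rho_bound.
  have : 0 <= (rm + rp) *
      (spread eps p.2 * ((mills 0)^-1 + (mills 0)^-1 + (mills (spread eps p.2))^-1)).
    rewrite mulr_ge0 ?addr_ge0 ?(ltW rm_gt0) ?(ltW rp_gt0)// mulr_ge0// !addr_ge0// invr_ge0 ltW//.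
  move: (spread _ _ * _) => K K0; move: rm_gt0 rp_gt0 => rm0 rp0.
  by rewrite /riemann_data; case: ifP => _; rewrite gtr0_norm//; lra.
have := rho_visc_formula_bound eps0 Bp um_le_up p.1 (ltW rm_gt0) (ltW rp_gt0).
have k0 := width_gt0 eps0 Bp.
have -> // : (up - um) * B p.2 / (2 * width eps (B p.2)) = spread eps p.2.
have BE : B p.2 = width eps (B p.2) * width eps (B p.2) / eps.
  by rewrite (width_sqr eps0 Bp); field; rewrite gt_eqF.
rewrite /spread [X in _ * X / _]BE; field.
by rewrite !gt_eqF.
Qed.

Lemma continuous_rho_bound eps : continuous (rho_bound eps).
Proof.
move=> t.
have cw : continuous (fun t => width eps (B t)).
  move=> r; apply: (@continuous_comp _ _ _ (fun t => eps * B t) Num.sqrt);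
    last exact: sqrt_continuous.
  by apply: cvgM; [exact: cvg_cst|exact: cB].
have cs : continuous (spread eps).
  by move=> r; apply: cvgM; [apply: cvgM; [exact: cvg_cst|exact: cw]|exact: cvg_cst].
apply: cvgM; first exact: cvg_cst.
apply: cvgD; first exact: cvg_cst.
apply: cvgM; first exact: cs.
apply: cvgD; first exact: cvg_cst.
apply: cvgV; first by rewrite gt_eqF// mills_gt0.
by apply: (continuous_comp (cs t)); exact: continuous_mills.
Qed.

Lemma L1loc_continuous (a : R -> R) : continuous a -> L1loc_half_line a.
Proof.
move=> ca T; have := integrable_continuousM ca (primitive_id 0 T).1.
by apply: eq_integrable => // x _ /=; rewrite mulr1.
Qed.

(** The density is the derivative of the potential by [is_derive_W_visc]; the bound of
[rho_profile_bound] depends continuously on time, including the times where B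
vanishes. *)
Lemma L1loc_rho_visc eps : 0 < eps ->
  L1loc (@open_half_plane R) (rho_visc alpha sigma rm rp um up eps).
Proof.
move=> eps0.
apply: (@L1loc_of_bound R _ _ (fun x t => rho_profile eps (x, t)) (rho_bound eps)
    open_sub_closed_half_plane).
- by have := @measurable_rho_profile eps; congr measurable_fun; apply/funext => -[].
- by move=> x t _; rewrite rho_viscE.
- exact/L1loc_continuous/continuous_rho_bound.
- by move=> x t _; exact: (@rho_profile_bound eps (x, t)).
Qed.

Section Test.
Variable phi : R * R -> R.
Hypothesis tphi : test_function (@open_half_plane R) phi.

Lemma test_support p : p.2 <= 0 -> phi p = 0.
Proof.
move=> p0; apply/eqP/negPn/negP => pp; case: tphi => _ _ sub.
have := sub p (@subset_closure _ [set p | phi p != 0] p pp).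
by rewrite /open_half_plane/= ltNge p0.
Qed.

(** The test function confines x and t to a bounded set and vanishes for t <= 0. *)
Lemma integrable_test_mul (f : R * R -> R) (a : R -> R) :
  measurable_fun setT (f : P -> R) -> L1loc_half_line a ->
  (forall x t, 0 <= t -> `|f (x, t)| <= a t) ->
  pm.-integrable setT (EFin \o (fun p : P => f p * phi p)).
Proof.
move=> mf ia fa.
have [M M0 phiM] := test_function_box tphi.
have cphi : continuous phi by case: tphi => /(_ 0%N) [].
have [C C0 phiC] := continuous_box_bounded cphi (fun p Mp => let: And3 e _ _ := phiM p Mp in e).
apply: (@integrable_strip R (fun p => f p * phi p) M ((fun t => C * a t) \_ `[0, M])).
- by apply: measurable_funM => //; exact: continuous_measurable_plane.
- rewrite -restrict_EFin; apply/integrable_restrict => //; rewrite setTI.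
  exact: integrableZ_itv.
- by move=> p Mp; have [-> _ _] := phiM p (or_introl (ltW Mp)); rewrite mulr0.
move=> [x t] /=; rewrite patchE mem_setE in_itv/=.
have [t0|t0] := leP 0 t; last by rewrite /= test_support ?mulr0 ?normr0// ltW.
have [tM|tM] := leP t M; last first.
  have [-> _ _] := phiM (x, t) (or_intror (le_trans (ltW tM) (ler_norm _))).
  by rewrite mulr0 normr0.
by rewrite /= normrM mulrC ler_pM// fa.
Qed.

Lemma Rintegral_open_half_plane (f g : R * R -> R) :
  (forall p, 0 < p.2 -> f p = g p) -> (forall p, p.2 <= 0 -> g p = 0) ->
  \int[pm]_(p in @open_half_plane R) f p = \int[pm]_p g p.
Proof.
move=> fg g0; rewrite Rintegral_mkcond; apply: eq_Rintegral => p _.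
rewrite patchE; case: ifPn => [|].
  by rewrite inE /open_half_plane/= => /fg.
by rewrite notin_setE /open_half_plane/= => /negP; rewrite -leNgt => /g0 ->.
Qed.

(** Where B = 0 the viscous and limit velocities both equal the initial data. *)
Lemma u_profile_cvg (e_ : R^nat) p : (forall n, 0 < e_ n) -> e_ n @[n --> \oo] --> 0 ->
  u_profile (e_ n) p @[n --> \oo] --> riemann_u um up p.1 (B p.2).
Proof.
move=> e0 ecvg; rewrite /u_profile; case: eqP => [B0|/eqP/B_pos Bp].
  rewrite B0; rewrite (_ : riemann_u _ _ _ _ = riemann_data um up p.1); first exact: cvg_cst.
  by rewrite /riemann_u /riemann_data !mulr0; case: (ltP p.1 0).
have lim : Num.sqrt (e_ n * B p.2) / B p.2 * (2 * mills_cst R) @[n --> \oo] --> 0.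
  rewrite -[X in _ --> X](_ : Num.sqrt (0 * B p.2) / B p.2 * (2 * mills_cst R) = 0); last first.
    by rewrite mul0r sqrtr0 !mul0r.
  apply: cvgM; last exact: cvg_cst.
  apply: cvgM; last exact: cvg_cst.
  apply: (cvg_comp (fun n => e_ n * B p.2) (@Num.sqrt R)); last exact: sqrt_continuous.
  by apply: cvgM => //; exact: cvg_cst.
apply/cvgrPdist_le => e epos.
move/cvgrPdist_le : lim => /(_ e epos); apply: filterS => n.
rewrite sub0r normrN => h.
rewrite distrC; apply: le_trans (U_visc_dist (e0 n) Bp um_le_up p.1) _.
exact: le_trans (ler_norm _) h.
Qed.

(** Dominated convergence along an arbitrary sequence of viscosities: before
damping the velocities stay between um and up. *)
Lemma u_visc_distribution_cvg :
  \int[pm]_(p in @open_half_plane R) (u_visc alpha sigma um up eps p.1 p.2 * phi p) @[eps --> 0^'+]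
  --> \int[pm]_(p in @open_half_plane R) (u p.1 p.2 * phi p).
Proof.
apply/cvg_at_rightP => e_ [e0 ecvg].
have bU := bounded_measurable_riemann_u alpha_ge0 alpha_L1 sigma_L1loc um_le_up.
pose f_ n (p : R * R) : R := u_profile (e_ n) p * (E p.2 * phi p).
pose f (p : R * R) : R := riemann_u um up p.1 (B p.2) * (E p.2 * phi p).
have iE : pm.-integrable setT (EFin \o (fun p : P => E p.2 * phi p)).
  apply: (@integrable_test_mul (fun p => E p.2) E).
  - exact: measurable_damping.
  - exact: L1loc_continuous.
  - by move=> x t _ /=; rewrite gtr0_norm// expR_gt0.
have mEphi : measurable_fun setT (fun p : P => E p.2 * phi p).
  by apply/measurable_EFinP; have /integrableP[] := iE.
have mf n : measurable_fun setT (f_ n : P -> R).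
  by apply: measurable_funM => //; have [] := bounded_measurable_u_profile (e0 n).
have mf0 : measurable_fun setT (f : P -> R) by apply: measurable_funM => //; case: bU.
have Eall eps : \int[pm]_(p in @open_half_plane R) (u_visc alpha sigma um up eps p.1 p.2 * phi p) =
    \int[pm]_p (u_profile eps p * (E p.2 * phi p)).
  apply: Rintegral_open_half_plane => [[x t]|p /test_support ->]; last by rewrite !mulr0.
  by rewrite /= u_viscE mulrA.
have El : \int[pm]_(p in @open_half_plane R) (u p.1 p.2 * phi p) = \int[pm]_p f p.
  apply: Rintegral_open_half_plane => [p _|p /test_support fp]; last by rewrite /f fp !mulr0.
  by rewrite /f /u /u_lim mulrA.
rewrite El; under eq_fun do rewrite Eall.
have [iF _ FF] : [/\ pm.-integrable setT (EFin \o f : P -> _),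
    [sequence (\int[pm]_p `|(f_ n p)%:E - (f p)%:E|)%E]_n @ \oo --> 0%E &
    [sequence (\int[pm]_p (f_ n p)%:E)%E]_n @ \oo --> (\int[pm]_p (f p)%:E)%E].
  apply: (@dominated_convergence _ _ _ pm setT measurableT
    (fun n p => (f_ n p)%:E) (fun p => (f p)%:E)
        (fun p => ((`|um| + `|up|) * `|E p.2 * phi p|)%:E)).
  - by move=> n; exact/measurable_EFinP.
  - exact/measurable_EFinP.
  - apply: aeW => p _; apply: cvg_EFin; first by near=> n.
    apply: cvgM; last exact: cvg_cst.
    exact: u_profile_cvg.
  - have := integrableZl measurableT (`|um| + `|up|) (integrable_norm iE).
    by apply: eq_integrable.
  - apply: aeW => p n _; rewrite /= lee_fin normrM ler_wpM2r//.
    by have [_] := bounded_measurable_u_profile (e0 n); exact.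
by apply: fine_cvg; rewrite fineK//; exact: integrable_fin_num.
Unshelve. all: by end_near. Qed.

(** Up to an affine function, W_lim is a combination of the positive parts of
x - um B and x - up B, whose derivatives are the steps of [riemann_rhoE]. *)
Lemma primitive_W_lim (a c t : R) :
  primitive a c (W_lim (B t) rm rp um up) (fun x => riemann_rho rm rp um up x (B t)).
Proof.
have [iG G] := primitive_lin rm 1 (primitive_id a c)
  (primitive_lin rp (- rm) (primitive_pospart a c (up * B t)) (primitive_pospart a c (um * B t))).
have gE : (fun x => riemann_rho rm rp um up x (B t)) = fun x => rm * 1 + 1 *
    (rp * (if up * B t <= x then 1 else 0) + - rm * (if um * B t <= x then 1 else 0)).
  by apply/funext => x; rewrite riemann_rhoE// /front_step mulr1 mul1r mulNr addrA.
have FE x : W_lim (B t) rm rp um up x = rm * x + 1 * (rp * Num.max (x - up * B t) 0 +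
    - rm * Num.max (x - um * B t) 0) - rm * (um * B t).
  rewrite /W_lim.
  have -> : Num.max (um * B t - x) 0 = Num.max (x - um * B t) 0 - (x - um * B t).
    have [xu|ux] := leP x (um * B t).
      have -> : Num.max (um * B t - x) 0 = um * B t - x by apply/max_idPl; rewrite subr_ge0.
      have -> : Num.max (x - um * B t) 0 = 0 by apply/max_idPr; rewrite subr_le0.
      by ring.
    have -> : Num.max (um * B t - x) 0 = 0 by apply/max_idPr; rewrite subr_le0 ltW.
    have -> : Num.max (x - um * B t) 0 = x - um * B t by apply/max_idPl; rewrite subr_ge0 ltW.
    by ring.
  by ring.
split; first by rewrite gE.
by move=> s r as_ sr rc; rewrite gE -G// !FE; ring.
Qed.

Lemma continuous_rho_formula eps t : 0 < eps -> 0 < B t ->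
  continuous (rho_visc_formula eps (B t) rm rp um up).
Proof.
move=> eps0 Bt x.
have ca : {for x, continuous (arg_m eps (B t) um)}.
  apply: differentiable_continuous; apply/derivable1_diffP.
  by have [] := is_derive_arg_m eps (B t) um x.
have cp : {for x, continuous (arg_p eps (B t) up)}.
  apply: differentiable_continuous; apply/derivable1_diffP.
  by have [] := is_derive_arg_p eps (B t) up x.
have cma : {for x, continuous (fun x => mills (arg_m eps (B t) um x))}.
  by apply: (continuous_comp ca); exact: continuous_mills.
have cmp : {for x, continuous (fun x => mills (arg_p eps (B t) up x))}.
  by apply: (continuous_comp cp); exact: continuous_mills.
have cslope : continuous (@mills_slope R).
  move=> y; apply: differentiable_continuous; apply/derivable1_diffP.
  by have [] := is_derive_mills_slope y.
have csa : {for x, continuous (fun x => mills_slope (arg_m eps (B t) um x))}.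
  by apply: (continuous_comp ca); exact: cslope.
have csp : {for x, continuous (fun x => mills_slope (arg_p eps (B t) up x))}.
  by apply: (continuous_comp cp); exact: cslope.
have cD : {for x, continuous (mills_sum eps (B t) um up)} by exact: cvgD cma cmp.
have D0 : mills_sum eps (B t) um up x != 0 by rewrite gt_eqF// mills_sum_gt0.
have cst_ (c : R) : {for x, continuous (fun _ : R => c)} by exact: cvg_cst.
have cV := cvgV D0 cD.
have cD2 : {for x, continuous (fun x => mills_sum eps (B t) um up x ^+ 2)}.
  by apply: cvgM; exact: cD.
have D20 : mills_sum eps (B t) um up x ^+ 2 != 0 by rewrite expf_neq0.
have cV2 := cvgV D20 cD2.
apply: cvgB.
  apply: cvgM; last exact: cV.
  apply: cvgD; (apply: cvgM; first exact: cst_); [exact: cma|exact: cmp].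
apply: cvgM; first exact: (cvgD ca cp).
apply: cvgD; (apply: cvgM; first exact: cst_); (apply: cvgM; last exact: cV2).
  by apply: cvgM; [exact: cmp|exact: csa].
by apply: cvgM; [exact: cma|exact: csp].
Qed.

(** On a horizontal line the difference of the densities is the x-derivative of the
difference of the potentials.  Moving the derivative to phi leaves the integral
of that difference, bounded by [W_visc_dist], against a derivative of phi bounded
by C on an interval of length 2M.  If B t = 0, the two densities are equal. *)
Lemma rho_line_bound (M C eps t : R) : 0 < eps -> 0 < M ->
  (forall p, M <= `|p.1| \/ M <= `|p.2| -> [/\ phi p = 0, dx phi p = 0 & dt phi p = 0]) ->
  (forall p, `|dx phi p| <= C) ->
  `|\int[mu]_x ((rho_profile eps (x, t) - rho x t) * phi (x, t))| <=
    width eps (B t) * ((`|rp| + `|rm|) * mills_cst R) * C * (M - - M).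
Proof.
move=> eps0 M0 phiM dxC.
have C0 : 0 <= C by apply: le_trans (dxC (0, 0)).
have MM : - M <= M by lra.
have w0 : 0 <= width eps (B t) by exact: sqrtr_ge0.
have Kc0 : 0 <= (`|rp| + `|rm|) * mills_cst R by apply: mulr_ge0;
  [exact: addr_ge0|exact: mills_cst_ge0].
rewrite /rho_profile /=; have [B0|/B_pos Bt] := eqVneq (B t) 0.
  rewrite (_ : (fun x => _) = cst 0).
    rewrite /Rintegral integral0 normr0; apply: mulr_ge0; last by lra.
    by apply: mulr_ge0 => //; exact: mulr_ge0.
  apply/funext => x; rewrite /rho /rho_lim -/(B t) B0 /riemann_rho /riemann_data !mulr0.
  by case: (ltP x 0) => _; rewrite subrr mul0r.
have [_ [d1 _ [cdx _] _]] : Ck 1 phi by case: tphi => /(_ 1%N).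
have cphi : continuous phi by case: tphi => /(_ 0%N) [].
pose G x := phi (x, t); pose g x := dx phi (x, t).
have cG : continuous G.
  by move=> x; apply: (continuous_comp (cvg_pair cvg_id (cvg_cst t))); exact: cphi.
have cg : continuous g.
  by move=> x; apply: (continuous_comp (cvg_pair cvg_id (cvg_cst t))); exact: cdx.
have pG : primitive (- M) M G g.
  apply: primitive_of_derive => // x; apply: DeriveDef; first exact: (d1 (x, t)).
  by rewrite /g /dx derive1E.
have pW : primitive (- M) M (W_visc eps (B t) rm rp um up) (rho_visc_formula eps (B t) rm rp um up).
  apply: primitive_of_derive; last exact: continuous_rho_formula.
  by move=> x; exact: is_derive_W_visc.
have pF := primitive_lin 1 (-1) pW (primitive_W_lim (- M) M t).
have cW : continuous (fun x => 1 * W_visc eps (B t) rm rp um up x + -1 * W_lim (B t) rm rp um up x).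
  have cmax (f : R -> R) : continuous f -> continuous (fun x => Num.max (f x) 0).
    move=> cf x.
    have -> : (fun x => Num.max (f x) 0) = (fun x => (f x + `|f x|) / 2).
      by apply/funext => y; case: (ger0P (f y)) => fy; lra.
    apply: cvgM; last exact: cvg_cst.
    by apply: cvgD; [exact: cf|apply: (continuous_comp (cf x)); exact: norm_continuous].
  move=> x; apply: cvgD; apply: cvgM; try exact: cvg_cst.
    apply: differentiable_continuous; apply/derivable1_diffP.
    by have [] := is_derive_W_visc eps0 Bt rm rp um up x.
  apply: cvgB; (apply: cvgM; first exact: cvg_cst).
    apply: (cmax (fun y => y - up * B t)) => y.
    by apply: cvgB; [exact: cvg_id|exact: cvg_cst].
  apply: (cmax (fun y => um * B t - y)) => y.
  by apply: cvgB; [exact: cvg_cst|exact: cvg_id].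
have GM : G M = 0.
  by have [] := phiM (M, t) (or_introl (ler_norm _)).
have GNM : G (- M) = 0.
  by have [] := phiM (- M, t) (or_introl _); rewrite //= normrN ler_norm.
have ibp := primitive_by_parts MM cW cG pF pG GNM GM.
have -> : \int[mu]_x ((rho_visc_formula eps (B t) rm rp um up x - rho x t) * phi (x, t)) =
   \int[mu]_(x in `[- M, M]) ((1 * rho_visc_formula eps (B t) rm rp um up x +
       -1 * riemann_rho rm rp um up x (B t)) * G x).
  rewrite [RHS]Rintegral_mkcond; apply: eq_Rintegral => x _;
    rewrite patchE mem_setE in_itv/= -ler_norml.
  case: ifPn => [_|]; first by rewrite mul1r mulN1r.
  by rewrite -ltNge => /ltW xM; have [-> _ _] := phiM (x, t) (or_introl xM); rewrite mulr0.
rewrite ibp normrN.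
have i1 := (primitive_id (- M) M).1.
have ic (c : R) : mu.-integrable `[- M, M] (EFin \o (fun=> c)).
  by have := integrableZ_itv c i1; apply: eq_integrable => // x _ /=; rewrite mulr1.
apply: (@le_trans _ _
    (\int[mu]_(x in `[- M, M]) (width eps (B t) * ((`|rp| + `|rm|) * mills_cst R) * C))).
  apply: le_Rintegral_itv => //; first exact: integrable_continuousM pG.1.
  move=> x _ _; rewrite normrM; apply: ler_pM => //; last exact: dxC.
  by rewrite mul1r mulN1r; exact: W_visc_dist.
have [_ /(_ (- M) M (lexx _) MM (lexx _)) E1] := primitive_id (- M) M.
rewrite E1 -RintegralZl//.
by rewrite le_eqVlt; apply/orP; left; apply/eqP; apply: eq_Rintegral => x _; rewrite mulr1.
Qed.

(** Integrating [rho_line_bound] over the bounded time interval where phi lives, on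
which B is bounded, gives an error of order eps^(1/2). *)
Lemma rho_visc_distribution_cvg :
  \int[pm]_(p in @open_half_plane R) (rho_visc alpha sigma rm rp um up eps p.1 p.2 * phi p)
      @[eps --> 0^'+]
  --> \int[pm]_(p in @open_half_plane R) (rho p.1 p.2 * phi p).
Proof.
have [M M0 phiM] := test_function_box tphi.
have cdx : continuous (dx phi) by case: tphi => /(_ 1%N) [_ [_ _ []]].
have [C C0 dxC] := continuous_box_bounded cdx (fun p Mp => let: And3 _ e _ := phiM p Mp in e).
have MM : - M <= M by lra.
(* t1 is a time at which B is largest on the time interval where phi lives. *)
have [t1 _ Bmax] := EVT_max (ltW M0) (continuous_subspaceT cB).
pose K := Num.sqrt (B t1) * ((`|rp| + `|rm|) * mills_cst R) * C * (M - - M) * M.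
have [mr [Cr rC]] := bounded_measurable_rho rm rp um up alpha_L1 sigma_L1loc.
have ir : pm.-integrable setT (EFin \o (fun p : P => rho p.1 p.2 * phi p)).
  apply: (@integrable_test_mul (fun p => rho p.1 p.2) (fun=> Cr)) => //.
    exact: L1loc_half_line_cst.
have ire eps : 0 < eps -> pm.-integrable setT (EFin \o (fun p : P => rho_profile eps p * phi p)).
  move=> eps0; apply: (@integrable_test_mul (rho_profile eps) (rho_bound eps)).
  - exact: measurable_rho_profile.
  - exact/L1loc_continuous/continuous_rho_bound.
  - by move=> x t _; exact: (@rho_profile_bound eps (x, t)).
have key eps : 0 < eps ->
  `|\int[pm]_(p in @open_half_plane R) (rho_visc alpha sigma rm rp um up eps p.1 p.2 * phi p) -
    \int[pm]_(p in @open_half_plane R) (rho p.1 p.2 * phi p)| <= Num.sqrt eps * K.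
  move=> eps0.
  have -> : \int[pm]_(p in @open_half_plane R)
      (rho_visc alpha sigma rm rp um up eps p.1 p.2 * phi p) =
      \int[pm]_p (rho_profile eps p * phi p).
    apply: Rintegral_open_half_plane => [[x t] _|p /test_support ->]; last by rewrite mulr0.
    by rewrite /= rho_viscE.
  have -> : \int[pm]_(p in @open_half_plane R) (rho p.1 p.2 * phi p) = \int[pm]_p
      (rho p.1 p.2 * phi p).
    by apply: Rintegral_open_half_plane => [//|p /test_support ->]; rewrite mulr0.
  have iD : pm.-integrable setT (EFin \o (fun p : P => (rho_profile eps p - rho p.1 p.2) * phi p)).
    have := integrableB measurableT (ire _ eps0) ir.
    by apply: eq_integrable => // p _ /=; rewrite mulrBl.
  rewrite -(RintegralB measurableT (ire _ eps0) ir).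
  under eq_Rintegral do rewrite -mulrBl.
  rewrite (Rintegral_plane21 iD).
  pose I t := \int[mu]_x ((rho_profile eps (x, t) - rho x t) * phi (x, t)).
  have I0 t : ~~ (0 <= t <= M) -> I t = 0.
    move=> tM; rewrite /I (_ : (fun x => _) = cst 0) ?/Rintegral ?integral0//.
    apply/funext => x; have -> : phi (x, t) = 0; last by rewrite mulr0.
    move: tM; rewrite negb_and -!ltNge => /orP[t0|/ltW tM]; first by rewrite test_support// ltW.
    by have [] := phiM (x, t) (or_intror (le_trans tM (ler_norm _))).
  have -> : \int[mu]_t \int[mu]_x ((rho_profile eps (x, t) - rho x t) * phi (x, t)) =
      \int[mu]_(t in `[0, M]) I t.
    rewrite [RHS]Rintegral_mkcond; apply: eq_Rintegral => t _.
    by rewrite patchE mem_setE in_itv/=; case: ifPn => // /I0.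
  have i1 := (primitive_id 0 M).1.
  pose c := Num.sqrt eps * (Num.sqrt (B t1) * ((`|rp| + `|rm|) * mills_cst R) * C * (M - - M)).
  have Ic t : 0 <= t -> t <= M -> `|I t| <= c * 1.
    move=> t0 tM; apply: (le_trans (rho_line_bound t eps0 M0 phiM dxC)).
    rewrite mulr1 /c /width sqrtrM; last exact: ltW.
    rewrite -!mulrA; apply: ler_wpM2l; first exact: sqrtr_ge0.
    apply: ler_wpM2r; last first.
      by rewrite ler_sqrt// Bmax// in_itv/= t0.
    apply: mulr_ge0; first exact: addr_ge0.
    by apply: mulr_ge0; [exact: mills_cst_ge0|apply: mulr_ge0 => //; lra].
  have mI : measurable_fun setT (I : measurableTypeR R -> R).
    have mG := measurable_fubini_G iD.
    by rewrite /I /Rintegral; apply: (measurableT_comp (f := @fine R)).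
  have iI : mu.-integrable `[0, M] (EFin \o I).
    have bI : [bounded I t | t in `[0, M]].
      exists (c * 1); split; first exact: num_real.
      move=> N cN t; rewrite /= in_itv/= => /andP[t0 tM].
      exact: le_trans (Ic t t0 tM) (ltW cN).
    have := @integrableMl _ _ _ mu `[0, M]%classic (measurable_itv _) _ _ i1
        (measurable_funTS mI) bI.
    by apply: eq_integrable => // x _ /=; rewrite mul1e.
  have E1 : \int[mu]_(t in `[0, M]) (c * 1) = c * M.
    have [_ /(_ 0 M (lexx _) (ltW M0) (lexx _)) E1] := primitive_id 0 M.
    by rewrite RintegralZl// -E1 subr0.
  have -> : Num.sqrt eps * K = c * M by rewrite /K /c !mulrA.
  rewrite -E1; apply: le_Rintegral_itv => //; exact: integrableZ_itv.
apply/cvgrPdist_le => e e0.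
have lim : Num.sqrt eps * K @[eps --> 0^'+] --> 0.
  apply: cvg_at_right_filter.
  rewrite -[X in _ --> X](_ : Num.sqrt 0 * K = 0); last by rewrite sqrtr0 mul0r.
  by apply: cvgM; [exact: sqrt_continuous|exact: cvg_cst].
move/cvgrPdist_le : lim => /(_ e e0) lim.
near=> eps.
have eps0 : 0 < eps by near: eps; exact: nbhs_right_gt.
rewrite distrC; apply: (le_trans (key _ eps0)).
have : `|0 - Num.sqrt eps * K| <= e by near: eps.
by rewrite sub0r normrN; apply: le_trans; exact: ler_norm.
Unshelve. all: by end_near. Qed.

End Test.

End Convergence.

(** * The vanishing viscosity limit *)

Theorem theorem2p1 (R : realType) (alpha sigma : R -> R) (rhom rhop um up : R)
    (alpha_ge0 : {ae @lebesgue_measure R, forall t, 0 <= t -> 0 <= alpha t})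
    (alpha_L1 : lebesgue_measure.-integrable `[0, +oo[ (EFin \o alpha))
    (sigma_ge0 : {ae @lebesgue_measure R, forall t, 0 <= t -> 0 <= sigma t})
    (sigma_L1loc : L1loc_half_line sigma)
    (rhom_gt0 : 0 < rhom) (rhop_gt0 : 0 < rhop) (um_le_up : um <= up) :
  let B := Bint alpha sigma in
  let xm := fun t => um * B t in
  let xp := fun t => up * B t in
  exists rho u : R -> R -> R,
    [/\ distribution_cvg (rho_visc alpha sigma rhom rhop um up) rho,
        distribution_cvg (u_visc alpha sigma um up) u,
        zeldovich_solution alpha sigma rhom rhop um up rho u,
        um < up -> forall x t, 0 < t ->
          [/\ x < xm t ->
                rho x t = rhom /\ u x t = um * damping sigma t,
              xm t < x < xp t ->
                rho x t = 0 /\ u x t = x / B t * damping sigma t &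
              xp t < x ->
                rho x t = rhop /\ u x t = up * damping sigma t] &
        um = up -> forall x t, 0 < t ->
          (x < xm t -> rho x t = rhom /\ u x t = um * damping sigma t) /\
          (xm t < x -> rho x t = rhop /\ u x t = um * damping sigma t)].
Proof.
move=> B xm xp.
have B_ge0 t : 0 <= B t by exact: Bint_ge0.
exists (rho_lim alpha sigma rhom rhop um up), (u_lim alpha sigma um up); split.
- split; [exact: L1loc_rho_visc|exact: L1loc_rho_lim|].
  by move=> phi; exact: rho_visc_distribution_cvg.
- split; [exact: L1loc_u_visc|exact: L1loc_u_lim|].
  by move=> phi; exact: u_visc_distribution_cvg.
- exact: zeldovich_solution_lim.
- move=> _ x t _; rewrite /rho_lim /u_lim /riemann_rho /riemann_u -/(B t) -/(xm t) -/(xp t).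
  have mp : xm t <= xp t by rewrite ler_wpM2r.
  split => [->//|/andP[xmx xxp]|xpx].
    by rewrite ltNge (ltW xmx) /= leNgt xxp.
  by rewrite ltNge (le_trans mp (ltW xpx)) /= (ltW xpx).
- move=> E x t _; rewrite /rho_lim /u_lim /riemann_rho /riemann_u -E -/(B t) -/(xm t).
  split => [->//|xmx].
  by rewrite ltNge (ltW xmx).
Qed.
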